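(* Suppose that $\mu$ satisfies a Poincaré inequality with constant $C_P$, i.e. $\mathrm{Var}_\mu(f)\le C_P\int\Gamma(f,f)\,d\mu$ for all smooth $f$. Then for every $p>2$ there is a constant $\lambda_p>0$ such that for all $f\in L^p(\mu)$ and all $t\ge0$, $$N_p(P_tf)\le e^{-\lambda_p t}\,N_p(f),$$ where $$\lambda_p\ \ge\ \frac{2^{k+6}}{2^{7\times 2^{k+1}}\,C_P}\qquad\text{if } 2^{k+1}\ge p>2^k \text{ for some integer } k>1.$$ Consequently, for $1<p<2$, for all $f\in L^p(\mu)$ and all $t\ge0$, $$N_p(P_tf)\le 2\,e^{-\lambda_p t}\,N_p(f)\qquad\text{with }\lambda_p=\lambda_{p/(p-1)}.$$
   Context: Setting. $(X_t)$ is a Markov process with infinitesimal generator $L$ and Polish state space $E$. The extended domain of $L$ contains a nice core $\mathcal D$ of uniformly continuous functions, which contains the constants and is an algebra; functions in $\mathcal D$ are called smooth. The carré du champ operator is $\Gamma(f,g)=\frac12\left(L(fg)-f\,Lg-g\,Lf\right)$, and the associated Dirichlet form is given for smooth $f$ by $\mathcal E(f,f)=-\int f\,Lf\,d\mu=\int\Gamma(f,f)\,d\mu$. The generator $L$ is $\mu$-symmetric for a probability measure $\mu$ on $E$, and generates a $\mu$-symmetric (hence stationary) semi-group $(P_t)_{t\ge0}$, which is a contraction semi-group on $L^p(\mu)$ for all $1\le p\le+\infty$, and for every $f\in L^2(\mu)$, $\|P_tf-\int f\,d\mu\|_{L^2(\mu)}\to0$ as $t\to+\infty$. The process is a diffusion: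 $\Gamma$ comes from a derivation, $\Gamma(fg,h)=f\,\Gamma(g,h)+g\,\Gamma(f,h)$, and the chain rule $L(\varphi(f))=\varphi'(f)\,Lf+\varphi''(f)\,\Gamma(f,f)$ holds for $\varphi$ of class $C^2$. Notation. $\|f\|_p^p=\int|f|^p\,d\mu$, $N_p(f)=\|f-\int f\,d\mu\|_p$, and $\mathrm{Var}_\mu(f)=\int f^2\,d\mu-\left(\int f\,d\mu\right)^2$. *)

(* Defs.v *)
From HB Require Import structures.
From mathcomp Require Import all_boot all_order all_algebra.
From mathcomp Require Import all_classical all_reals all_analysis.
Set Implicit Arguments.
Unset Strict Implicit.
Unset Printing Implicit Defensive.
Import Order.TTheory GRing.Theory Num.Theory.
Import numFieldNormedType.Exports.
Local Open Scope classical_set_scope.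
Local Open Scope ring_scope.

(* A Polish space is given with a complete distance that induces its topology:
   the uniform continuity of smooth functions refers to that distance. *)
Definition polish (R : realType) (E : completePseudoMetricType R) : Prop :=
  hausdorff_space E /\ (exists2 S : set E, countable S & dense S).

(* The carrier of E with the Borel sigma-algebra as measurable structure. *)
Definition borel (R : realType) (E : completePseudoMetricType R) :=
  g_sigma_algebraType (@open E).

Definition C2 (R : realType) (phi : R -> R) : Prop :=
  [/\ forall x, derivable phi x 1,
      forall x, derivable (derive1 phi) x 1 &
      continuous (derive1 (derive1 phi))].

Definition bounded_function (R : realType) (phi : R -> R) : Prop :=
  exists M : R, forall x, `|phi x| <= M.

Section semigroup.
Context (R : realType) (E : completePseudoMetricType R).
Context (mu : probability (borel E) R).

Definition Lp_norm (p : \bar R) (f : borel E -> R) : \bar R :=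
  'N[mu]_p[EFin \o f]%E.

Definition centered_norm (p : R) (f : borel E -> R) : \bar R :=
  Lp_norm p%:E (fun x => f x - \int[mu]_y f y).

(* Only the kernels P t with 0 <= t matter. *)
Context (P : R -> R.-pker (borel E) ~> (borel E)).

(* P_t f (x) = E_x[f(X_t)].  For f in L^p(mu), the integral converges for
   mu-almost every x, by stationarity. *)
Definition semigroup (t : R) (f : borel E -> R) : borel E -> R :=
  fun x => \int[P t x]_y f y.

Record symmetric_ergodic_markov_semigroup : Prop := {
  semigroup_0 : forall x (A : set (borel E)), measurable A -> P 0 x A = \d_x A ;
  chapman_kolmogorov : forall s t x (A : set (borel E)), 0 <= s -> 0 <= t ->
    measurable A -> P (s + t) x A = (\int[P s x]_y P t y A)%E ;
  semigroup_symmetric : forall t f g, 0 <= t ->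
    f \in Lfun mu 2%:E -> g \in Lfun mu 2%:E ->
    \int[mu]_x (f x * semigroup t g x) = \int[mu]_x (semigroup t f x * g x) ;
  semigroup_contraction : forall t (p : \bar R) f, 0 <= t -> (1 <= p)%E ->
    f \in Lfun mu p -> (Lp_norm p (semigroup t f) <= Lp_norm p f)%E ;
  semigroup_ergodic : forall f, f \in Lfun mu 2%:E ->
    Lp_norm 2%:E (fun x => semigroup t f x - \int[mu]_y f y) @[t --> +oo] --> 0%E
}.

(* The graph of the infinitesimal generator of (P_t) in L^p(mu): f is in its
   domain and is mapped to (the class of) g. *)
Definition generator (p : \bar R) (f g : borel E -> R) : Prop :=
  [/\ f \in Lfun mu p, g \in Lfun mu p &
      Lp_norm p (fun x => t^-1 * (semigroup t f x - f x) - g x)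
        @[t --> 0^'+] --> 0%E].

(* The extended generator: g is attached to f when
   f(X_t) - f(X_0) - \int_0^t g(X_s) ds is a martingale for the stationary
   process.  By the Markov property this means that
   P_t f - f = \int_0^t P_s g ds in L^1(mu) for all t >= 0, i.e. that (f, g) is
   in the graph of the generator in L^1(mu). *)
Definition extended_generator (f g : borel E -> R) : Prop := generator 1%E f g.

Context (D : set (borel E -> R)).
Context (L : (borel E -> R) -> (borel E -> R)).

(* carre du champ *)
Definition Gamma (f g : borel E -> R) : borel E -> R := fun x =>
  2^-1 * (L (f \* g) x - f x * L g x - g x * L f x).

(* D is an algebra of uniformly continuous functions and a core of the
   generator in L^2(mu); L f is a version of the generator at f, for f in D.
   The density of D in L^2(mu) makes the generator densely defined, which, for
   a contraction semigroup, amounts to strong continuity. *)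
Record smooth_core : Prop := {
  smooth_unif_continuous : forall f : E -> R, D f -> unif_continuous f ;
  smooth_cst : forall c : R, D (cst c) ;
  smoothD : forall f g, D f -> D g -> D (f \+ g) ;
  smoothZ : forall (a : R) f, D f -> D (fun x => a * f x) ;
  smoothM : forall f g, D f -> D g -> D (f \* g) ;
  smooth_generator : forall f, D f -> generator 2%:E f (L f) ;
  smooth_dense : forall f (e : R), f \in Lfun mu 2%:E -> 0 < e ->
    exists2 h, D h & (Lp_norm 2%:E (f \- h)%R < e%:E)%E ;
  smooth_graph_dense : forall f g (e : R), generator 2%:E f g -> 0 < e ->
    exists h, [/\ D h, (Lp_norm 2%:E (f \- h)%R < e%:E)%E &
                  (Lp_norm 2%:E (g \- L h)%R < e%:E)%E]
}.

(* The chain rule gives the value of the extended generator at phi(f) for every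
   phi of class C^2 such that phi(f) belongs to its domain.  That phi(f) does
   belong to it is only required for bounded phi' and phi'': then phi(f) and
   phi'(f) Lf + phi''(f) Gamma(f,f) are always integrable, whereas for an
   unbounded f and a general phi, phi(f(X_t)) is but a semimartingale whose
   local martingale part need not be a martingale. *)
Record diffusion : Prop := {
  derivation : forall f g h, D f -> D g -> D h ->
    {ae mu, forall x, Gamma (f \* g) h x = f x * Gamma g h x + g x * Gamma f h x} ;
  smooth_comp : forall f phi, D f -> C2 phi ->
    bounded_function (derive1 phi) -> bounded_function (derive1 (derive1 phi)) ->
    exists g, extended_generator (phi \o f) g ;
  chain_rule : forall f phi g, D f -> C2 phi ->
    extended_generator (phi \o f) g ->
    {ae mu, forall x, g x =
       derive1 phi (f x) * L f x + derive1 (derive1 phi) (f x) * Gamma f f x}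
}.

Definition poincare (CP : R) : Prop := forall f, D f ->
  ('V_mu[f] <= (CP * \int[mu]_x Gamma f f x)%:E)%E.

End semigroup.

(* Main.v *)
Require Import Defs.
From HB Require Import structures.
From mathcomp Require Import all_boot all_order all_algebra.
From mathcomp Require Import all_classical all_reals all_analysis.
From mathcomp Require Import measurable_realfun giry.
From mathcomp Require Import zify ring lra.
Import Order.TTheory GRing.Theory Num.Theory.
Import numFieldNormedType.Exports.
Local Open Scope classical_set_scope.
Local Open Scope ring_scope.

(** The decay of N_2, for the rate 1/C_P, comes from the spectral gap: for (f, g)
in the graph of the generator and f centered, the symmetry of P_h gives
    |P_h u|_2^2 = <u, P_2h u> = |u|_2^2 + 2h <u, g'> + 2h <u, r>,
where u = P_s f, g' = P_s g and r is the error made when the generator is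
replaced by the difference quotient at time 2h.  Poincare's inequality, which
extends from the core to the whole domain of the generator, bounds <u, g'> by
- |u|_2^2 / C_P, and the contraction property bounds |r|_2 by its value at
s = 0.  Iterating this t/h times and letting h tend to 0 gives
Var(P_t f) <= exp(-2t/C_P) Var(f) ([spectral_gap]).

For p > 2, write phi(x) = sg(x) |x|^(p/2).  The inequality
    |b|^p + p sg(b) |b|^(p-1) (a - b) + (phi(a) - phi(b))^2 / 2 <= |a|^p
([tangent_spow]), integrated in a under a probability of mean b, reinforces
Jensen's inequality ([jensen_spow]).  Applied to the law P_t(x, .) and to
a = u(y), then integrated in x under the invariant measure mu, it yields
    int |P_t u|^p + (int phi(u)^2 - int (P_t phi(u))^2) / 2 <= int |u|^p.
The spectral gap, applied to phi(u) which is in L^2, bounds the bracket from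
below by (1 - exp(-2t/C_P)) Var(phi(u)).  Finally, Var(phi(u)) is at least
2^(-2p-1) int |u|^p when u is centered ([variance_spow_ge]), because
|phi(x) - phi(a)|^2 >= 2^(-p) |x - a|^p.  Hence int |P_h u|^p is smaller than
int |u|^p by a factor 1 - c h for small h; the semigroup property turns this
into an exponential decay ([Lp_decay]), whose rate is compared with the
announced one in [decay_rate_ge].

For 1 < p < 2, the norm of v = P_t f in L^p is attained by duality against
w = sg(v) |v|^(p-1), which is in L^q for the conjugate exponent q > 2; by
symmetry P_t passes from f to w, and the decay in L^q applies to w once it is
centered, which costs the factor 2.  This is done for bounded f, for which
everything is in L^2, and extended by density ([dual_decay]). *)

Set Implicit Arguments.
Unset Strict Implicit.
Unset Printing Implicit Defensive.

(** * Signed powers and pointwise inequalities *)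


Section signed_power.
Context {R : realType}.
Implicit Types (a b p s x : R).

(** The signed power sg(x) |x|^s, an increasing odd function for s > 0. *)
Definition spow s x : R := Num.sg x * `|x| `^ s.

Lemma spow_ge0E s x : 0 < s -> 0 <= x -> spow s x = x `^ s.
Proof.
move=> s0; rewrite le_eqVlt => /predU1P[<-|x0].
  by rewrite /spow sgr0 mul0r powR0 ?gt_eqF.
by rewrite /spow gtr0_sg// mul1r gtr0_norm.
Qed.

Lemma spowN s x : spow s (- x) = - spow s x.
Proof. by rewrite /spow sgrN normrN mulNr. Qed.

Lemma normr_spow s x : 0 < s -> `|spow s x| = `|x| `^ s.
Proof.
move=> s0; rewrite /spow normrM normr_sg (ger0_norm (powR_ge0 _ _)).
have [->|x0] := eqVneq x 0; last by rewrite mul1r.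
by rewrite normr0 powR0 ?gt_eqF// mulr0.
Qed.

Lemma sqr_spow p x : 0 < p -> spow (p / 2) x ^+ 2 = `|x| `^ p.
Proof.
move=> p0; rewrite -real_normK ?num_real// normr_spow ?divr_gt0//.
by rewrite -powR_mulrn ?powR_ge0// -powRrM divfK.
Qed.

Lemma spow_surj s y : 0 < s -> exists x, spow s x = y.
Proof.
move=> s0; exists (spow s^-1 y).
have [y0|y0] := leP 0 y.
  rewrite (spow_ge0E (x := y)) ?invr_gt0// spow_ge0E ?powR_ge0//.
  by rewrite -powRrM mulVf ?gt_eqF// powRr1.
have ny0 : 0 <= - y by lra.
have -> : spow s^-1 y = - (- y) `^ s^-1.
  by rewrite -{1}(opprK y) spowN spow_ge0E ?invr_gt0.
rewrite spowN spow_ge0E ?powR_ge0// -powRrM mulVf ?gt_eqF// powRr1//.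
exact: opprK.
Qed.

(** Young's inequality for a b and b^(p-2), with the exponent p/2 and its
conjugate p/(p-2). *)
Lemma weighted_AGM p a b : 2 < p -> 0 <= a -> 0 < b ->
  p * (a * b `^ (p - 1)) <= 2 * (a `^ (p / 2) * b `^ (p / 2)) + (p - 2) * b `^ p.
Proof.
move=> p2 a0 b0.
have q0 : 0 < p / (p - 2) by apply: divr_gt0; lra.
have conj : (p / 2)^-1 + (p / (p - 2))^-1 = 1 by rewrite !invf_div; field; lra.
have := @conjugate_powR R (a * b) (b `^ (p - 2)) (p / 2) (p / (p - 2)) _ _ _ q0 conj.
rewrite mulr_ge0 ?(ltW b0)// powR_ge0 divr_gt0//; last by lra.
move=> /(_ isT isT isT); rewrite powRM ?(ltW b0)// -powRrM.
have -> : a * b * b `^ (p - 2) = a * b `^ (p - 1).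
  rewrite -mulrA; congr (_ * _).
  rewrite -{1}(powRr1 (ltW b0)) -powRD ?(gt_eqF b0) ?implybT//.
  by congr (_ `^ _); ring.
have -> : (p - 2) * (p / (p - 2)) = p by field; lra.
move=> h; have : p * (a * b `^ (p - 1)) <= p *
  (a `^ (p / 2) * b `^ (p / 2) / (p / 2) + b `^ p / (p / (p - 2))).
  by rewrite ler_pM2l//; lra.
move/le_trans; apply; rewrite le_eqVlt; apply/orP; left; apply/eqP; field.
lra.
Qed.

(** The graph of |x|^p lies above its tangent line at b, and the gap dominates
half of the squared increment of the signed power of exponent p/2. *)
Lemma tangent_spow p a b : 2 < p ->
  `|b| `^ p + p * spow (p - 1) b * (a - b)
    + 2^-1 * (spow (p / 2) a - spow (p / 2) b) ^+ 2 <= `|a| `^ p.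
Proof.
move=> p2.
have p0 : 0 < p by lra.
have p10 : 0 < p - 1 by lra.
have s0 : 0 < p / 2 by lra.
(* Both sides are invariant under (a, b) -> (-a, -b). *)
suff main a' b' : 0 <= b' -> `|b'| `^ p + p * spow (p - 1) b' * (a' - b')
    + 2^-1 * (spow (p / 2) a' - spow (p / 2) b') ^+ 2 <= `|a'| `^ p.
  have [b0|b0] := leP 0 b; first exact: main.
  have := main (- a) (- b); rewrite !spowN !normrN.
  rewrite (_ : 0 <= - b); last by lra.
  move=> /(_ isT); apply: le_trans.
  by rewrite le_eqVlt; apply/orP; left; apply/eqP; ring.
move=> {a b}; move: a' b' => a b; rewrite le_eqVlt => /predU1P[<-|b0].
  rewrite !(@spow_ge0E _ 0)// normr0 !powR0 ?gt_eqF// mulr0 mul0r !add0r subr0 sqr_spow//.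
  have := powR_ge0 `|a| p; lra.
rewrite (spow_ge0E p10 (ltW b0)) (gtr0_norm b0).
have bp : b * b `^ (p - 1) = b `^ p by rewrite mulr_powRB1// ltW.
have := @sqr_spow p a p0; have := @sqr_spow p b p0.
rewrite (gtr0_norm b0) (spow_ge0E s0 (ltW b0)).
have := powR_ge0 b (p - 1); have := powR_ge0 b p.
have [a0|a0] := leP 0 a.
  rewrite (spow_ge0E s0 a0).
  (* For a >= 0 the bound even holds with the full square: it amounts to
     the weighted AM-GM inequality. *)
  have := weighted_AGM p2 a0 b0.
  move: bp; set X := a `^ _; set Y := b `^ (p / 2); set Z := b `^ (p - 1).
  set A := `|a| `^ p; set B := b `^ p => bZ agm B0 Z0 YB XA.
  have -> : B + p * Z * (a - b) = B + p * (a * Z) - p * B by rewrite -bZ; ring.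
  have := sqr_ge0 (X - Y); nra.
(* For a < 0 < b, half the square is at most |a|^p + b^p, and the tangent line
   is below (1 - p) b^p. *)
set X := spow (p / 2) a; set Y := b `^ (p / 2).
move: bp; set Z := b `^ (p - 1); set A := `|a| `^ p; set B := b `^ p.
move=> bZ B0 Z0 YB XA.
have -> : B + p * Z * (a - b) = B - p * (Z * (- a)) - p * B by rewrite -bZ; ring.
have : 0 <= Z * (- a) by apply: mulr_ge0 => //; lra.
move: (Z * - a) => W W0.
have := sqr_ge0 (X + Y); nra.
Qed.

Lemma superadditive_powR s x y : 1 <= s -> 0 <= x -> 0 <= y ->
  x `^ s + y `^ s <= (x + y) `^ s.
Proof.
move=> s1 x0 y0; have s0 : 0 < s by lra.
rewrite -(mulr_powRB1 x0 s0) -(mulr_powRB1 y0 s0) -(mulr_powRB1 (addr_ge0 x0 y0) s0).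
rewrite mulrDl lerD// ler_wpM2l//; apply: ge0_ler_powR; rewrite ?nnegrE//; lra.
Qed.

Lemma powRD_le s x y : 0 <= s -> 0 <= x -> 0 <= y ->
  (x + y) `^ s <= 2 `^ s * (x `^ s + y `^ s).
Proof.
move=> s0; wlog xy : x y / x <= y => [hw|] x0 y0.
  by have [xy|/ltW yx] := leP x y; [|rewrite addrC [X in _ * X]addrC]; exact: hw.
have : (x + y) `^ s <= (2 * y) `^ s by apply: ge0_ler_powR; rewrite ?nnegrE//; lra.
move=> /le_trans; apply; rewrite powRM//.
by rewrite ler_wpM2l ?powR_ge0// lerDr powR_ge0.
Qed.

Lemma normrD_powR_le s x y : 0 <= s ->
  `|x + y| `^ s <= 2 `^ s * (`|x| `^ s + `|y| `^ s).
Proof.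
move=> s0; apply: le_trans (powRD_le s0 (normr_ge0 _) (normr_ge0 _)).
by apply: ge0_ler_powR; rewrite ?nnegrE// ?addr_ge0// ler_normD.
Qed.

(** For a and b of the same sign this is the superadditivity of x^s; for opposite
signs, |a - b| is the sum of |a| and |b|. *)
Lemma spow_dist s a b : 1 <= s ->
  `|a - b| `^ s <= 2 `^ s * `|spow s a - spow s b|.
Proof.
move=> s1; have s0 : 0 < s by lra.
have two1 : 1 <= (2 : R) `^ s.
  by have := ler_powR (ler1n R 2 : 1 <= 2) (ltW s0); rewrite powRr0.
wlog ab : a b / b <= a => [hw|].
  have [|/ltW] := leP b a; first exact: hw.
  by rewrite distrC (distrC (spow s a)); exact: hw.
wlog a0 : a b ab / 0 <= a => [hw|].
  have [a0|a0] := leP 0 a; first exact: hw.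
  have := hw (- b) (- a); rewrite !spowN.
  rewrite (_ : - b - - a = a - b); last by ring.
  rewrite (_ : - _ - - _ = spow s a - spow s b); last by ring.
  by apply; lra.
rewrite ger0_norm; last by lra.
rewrite (spow_ge0E s0 a0).
have [b0|b0] := leP 0 b.
  rewrite (spow_ge0E s0 b0).
  have := @superadditive_powR s (a - b) b s1 _ b0.
  rewrite subrK (_ : 0 <= a - b); last by lra.
  move=> /(_ isT) h; have D0 : 0 <= a `^ s - b `^ s.
    by have := powR_ge0 (a - b) s; lra.
  rewrite (ger0_norm D0); apply: (@le_trans _ _ (a `^ s - b `^ s)); first lra.
  by rewrite -{1}(mul1r (_ - _)) ler_wpM2r.
have bn : 0 <= - b by lra.
have -> : spow s b = - (- b) `^ s by rewrite -{1}(opprK b) spowN (spow_ge0E s0).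
rewrite opprK ger0_norm ?addr_ge0 ?powR_ge0//.
exact: powRD_le (ltW s0) a0 bn.
Qed.

Lemma sqr_spow_dist p a b : 2 < p ->
  `|a - b| `^ p <= 2 `^ p * (spow (p / 2) a - spow (p / 2) b) ^+ 2.
Proof.
move=> p2; have s1 : 1 <= p / 2 by lra.
have sqE (x : R) : 0 <= x -> x `^ p = (x `^ (p / 2)) ^+ 2.
  by move=> x0; rewrite -powR_mulrn ?powR_ge0// -powRrM divfK.
rewrite !sqE// -(real_normK (num_real (spow _ a - _))) -exprMn.
by rewrite lerXn2r ?nnegrE ?mulr_ge0 ?powR_ge0//; exact: spow_dist.
Qed.

Lemma measurable_spow p : 0 < p -> measurable_fun setT (spow p).
Proof.
move=> p0; have -> : spow p = (fun x => if 0 <= x then x `^ p else - (- x) `^ p).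
  apply/funext => x; case: ifPn => [x0|]; first exact: spow_ge0E.
  by rewrite -ltNge => x0; rewrite -{1}(opprK x) spowN spow_ge0E// oppr_ge0 ltW.
apply: measurable_fun_ifT => //.
- exact: measurable_fun_ler.
- apply: measurableT_comp => //; apply: (measurableT_comp (measurable_powR _)) => //.
Qed.

Lemma expRN_le x : 0 <= x -> x <= 1 -> expR (- x) <= 1 - x / 2.
Proof.
move=> x0 x1; have : expR (- x) * (1 + x) <= 1.
  by rewrite -[leRHS](expRxMexpNx_1 x) mulrC ler_wpM2r ?expR_ge0// expR_ge1Dx.
have := expR_gt0 (- x); nra.
Qed.

End signed_power.

(** * Real-valued integration and L^p norms *)

Section integrable_EFin.
Context d (T : measurableType d) (R : realType).
Variable m : {measure set T -> \bar R}.
Implicit Types (f g : T -> R).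

Lemma integrable_EFinZ c f : m.-integrable setT (EFin \o f) ->
  m.-integrable setT (EFin \o (fun x => c * f x)).
Proof. by move=> fi; exact: (integrableZl measurableT c fi). Qed.

Lemma integrable_EFinD f g : m.-integrable setT (EFin \o f) ->
  m.-integrable setT (EFin \o g) ->
  m.-integrable setT (EFin \o (fun x => f x + g x)).
Proof. by move=> fi gi; exact: (integrableD measurableT fi gi). Qed.

Lemma integrable_EFinB f g : m.-integrable setT (EFin \o f) ->
  m.-integrable setT (EFin \o g) ->
  m.-integrable setT (EFin \o (fun x => f x - g x)).
Proof. by move=> fi gi; exact: (integrableB measurableT fi gi). Qed.

End integrable_EFin.

Section Lp_toolkit.
Context d (T : measurableType d) (R : realType) (mu : probability T R).
Implicit Types (f g : T -> R) (p q c : R).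

(** The L^p norm as a real number; it is meaningful for f in L^p only, being 0
when the norm is infinite. *)
Definition Lpnorm p f : R := fine 'N[mu]_p%:E[EFin \o f].

Lemma Lfun_measurable (p : \bar R) f : f \in Lfun mu p -> measurable_fun setT f.
Proof. by rewrite inE => /andP[/[!inE]]. Qed.

Lemma measurable_normr_powR p f : measurable_fun setT f ->
  measurable_fun setT (fun x => `|f x| `^ p).
Proof.
move=> mf; apply: (measurableT_comp (measurable_powR _)) => //.
exact: measurableT_comp.
Qed.

Lemma LnormE p f : p != 0 ->
  ('N[mu]_p%:E[EFin \o f] = (\int[mu]_x (`|f x| `^ p)%:E) `^ p^-1)%E.
Proof.
move=> p0; rewrite unlock.
by congr (_ `^ _)%E; apply: eq_integral => x _ /=; rewrite poweR_EFin.
Qed.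

Lemma LfunP_powR p f : 1 <= p -> f \in Lfun mu p%:E <->
  measurable_fun setT f /\ mu.-integrable setT (fun x => (`|f x| `^ p)%:E).
Proof.
move=> p1; split => [fp|[mf fi]].
  by split; [exact: Lfun_measurable fp|exact: Lfun_integrable].
rewrite inE; apply/andP; split; rewrite inE//=.
rewrite /finite_norm LnormE ?gt_eqF ?(lt_le_trans ltr01)// poweR_lty//.
exact: integrable_lty.
Qed.

Lemma LfunD p f g : 1 <= p -> f \in Lfun mu p%:E -> g \in Lfun mu p%:E ->
  (fun x => f x + g x) \in Lfun mu p%:E.
Proof.
move=> p1 fp gp; have p1' : (1 <= p%:E)%E by rewrite lee_fin.
have [_ h] := Lfun_addr_closed mu p1'; exact: (h f g fp gp).
Qed.

Lemma LfunZ p c f : 1 <= p -> f \in Lfun mu p%:E ->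
  (fun x => c * f x) \in Lfun mu p%:E.
Proof.
move=> p1 fp; have -> : (fun x => c * f x) = c \o* f.
  by apply/funext => x; rewrite /= mulrC.
exact: Lfun_scale.
Qed.

Lemma LfunN p f : 1 <= p -> f \in Lfun mu p%:E -> (fun x => - f x) \in Lfun mu p%:E.
Proof.
move=> p1 fp; have -> : (fun x => - f x) = (fun x => -1 * f x).
  by apply/funext => x; rewrite mulN1r.
exact: LfunZ.
Qed.

Lemma LfunB p f g : 1 <= p -> f \in Lfun mu p%:E -> g \in Lfun mu p%:E ->
  (fun x => f x - g x) \in Lfun mu p%:E.
Proof. by move=> p1 fp gp; apply: LfunD => //; exact: LfunN. Qed.

Lemma Lfun_le p q f : 1 <= p -> p <= q -> f \in Lfun mu q%:E -> f \in Lfun mu p%:E.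
Proof.
move=> p1 pq; apply: (@Lfun_subset _ _ _ mu p%:E q%:E) => //; rewrite ?lee_fin//.
  exact: le_trans pq.
exact: fin_num_measure.
Qed.

Lemma Lfun_int p f : 1 <= p -> f \in Lfun mu p%:E -> mu.-integrable setT (EFin \o f).
Proof. by move=> p1 fp; apply/Lfun1_integrable; exact: Lfun_le fp. Qed.

Lemma Lfun_bounded p M f : 1 <= p -> measurable_fun setT f ->
  (forall x, `|f x| <= M) -> f \in Lfun mu p%:E.
Proof.
move=> p1 mf fM; apply/LfunP_powR => //; split => //.
apply: (@le_integrable _ _ _ mu setT measurableT _ (EFin \o cst (`|M| `^ p))).
- by apply/measurable_EFinP; exact: measurable_normr_powR.
- move=> x _ /=; rewrite lee_fin !(ger0_norm (powR_ge0 _ _)).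
  apply: ge0_ler_powR; rewrite ?nnegrE//; first lra.
  by rewrite (le_trans (fM x))// ler_norm.
- exact: finite_measure_integrable_cst.
Qed.

Lemma EFin_Lpnorm p f : f \in Lfun mu p%:E ->
  ((Lpnorm p f)%:E = 'N[mu]_p%:E[EFin \o f])%E.
Proof.
rewrite inE => /andP[_ /[!inE]/= fp]; rewrite /Lpnorm fineK//.
by rewrite ge0_fin_numE ?Lnorm_ge0.
Qed.

Lemma Lpnorm_ge0 p f : 0 <= Lpnorm p f.
Proof. by rewrite fine_ge0// Lnorm_ge0. Qed.

Lemma LpnormE p f : 1 <= p -> Lpnorm p f = (\int[mu]_x (`|f x| `^ p)) `^ p^-1.
Proof.
by move=> p1; rewrite /Lpnorm LnormE ?gt_eqF ?(lt_le_trans ltr01)// fine_poweR.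
Qed.

Lemma Lpnorm_powR p f : 1 <= p -> Lpnorm p f `^ p = \int[mu]_x (`|f x| `^ p).
Proof.
move=> p1; rewrite LpnormE// -powRrM mulVf ?gt_eqF ?(lt_le_trans ltr01)//.
by rewrite powRr1// Rintegral_ge0// => x _; exact: powR_ge0.
Qed.

Lemma LpnormD p f g : 1 <= p -> f \in Lfun mu p%:E -> g \in Lfun mu p%:E ->
  Lpnorm p (fun x => f x + g x) <= Lpnorm p f + Lpnorm p g.
Proof.
move=> p1 fp gp; rewrite -lee_fin EFinD !EFin_Lpnorm ?LfunD//.
by apply: (@minkowski_EFin _ _ _ mu f g p _ _ p1);
  [exact: Lfun_measurable fp|exact: Lfun_measurable gp].
Qed.

Lemma eq_Lpnorm p f g : f =1 g -> Lpnorm p f = Lpnorm p g.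
Proof. by move=> /funext ->. Qed.

Lemma LpnormN p f : Lpnorm p (fun x => - f x) = Lpnorm p f.
Proof. by congr fine; exact: (oppe_Lnorm mu (EFin \o f)). Qed.

Lemma Rintegral_cst_prob c : \int[mu]_x c = c.
Proof.
by rewrite /Rintegral; have := expectation_cst mu c; rewrite unlock => /= ->.
Qed.

Lemma integrable_EFin_cst c : mu.-integrable setT (EFin \o (fun=> c)).
Proof. exact: finite_measure_integrable_cst. Qed.

Lemma Lpnorm_cst p c : 1 <= p -> Lpnorm p (cst c) = `|c|.
Proof.
move=> p1; have p0 : p != 0 by rewrite gt_eqF ?(lt_le_trans ltr01).
rewrite LpnormE//= Rintegral_cst_prob.
by rewrite -powRrM mulfV// powRr1.
Qed.

Lemma ae_eq_Rintegral f g : measurable_fun setT f -> measurable_fun setT g ->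
  {ae mu, forall x, f x = g x} -> \int[mu]_x f x = \int[mu]_x g x.
Proof.
move=> mf mg fg; congr fine; apply: ae_eq_integral => //.
- exact/measurable_EFinP.
- exact/measurable_EFinP.
- by apply: filterS fg => x -> _.
Qed.

Lemma ae_eq_Lpnorm p f g :
  1 <= p -> measurable_fun setT f -> measurable_fun setT g ->
  {ae mu, forall x, f x = g x} -> Lpnorm p f = Lpnorm p g.
Proof.
move=> p1 mf mg fg; rewrite !(LpnormE _ p1).
rewrite (@ae_eq_Rintegral _ (fun x => `|g x| `^ p))//.
- exact: measurable_normr_powR.
- exact: measurable_normr_powR.
- by apply: filterS fg => x ->.
Qed.

Lemma ae_eq_Lfun p f g : 1 <= p -> measurable_fun setT g ->
  {ae mu, forall x, f x = g x} -> f \in Lfun mu p%:E -> g \in Lfun mu p%:E.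
Proof.
move=> p1 mg fg /(LfunP_powR f p1)[mf fi]; apply/LfunP_powR => //; split => //.
have mgp : measurable_fun setT (fun x => (`|g x| `^ p)%:E).
  by apply/measurable_EFinP; exact: measurable_normr_powR.
apply/integrableP; split => //.
have /integrableP[mfp] := fi.
have -> : (\int[mu]_x `|(`|f x| `^ p)%:E| = \int[mu]_x `|(`|g x| `^ p)%:E|)%E.
  apply: ae_eq_integral; [exact: measurableT|exact: measurableT_comp mfp
    |exact: measurableT_comp mgp|].
  by apply: filterS fg => x /= -> _.
exact.
Qed.

Lemma ae_le_Rintegral f g :
  mu.-integrable setT (EFin \o f) -> mu.-integrable setT (EFin \o g) ->
  {ae mu, forall x, f x <= g x} -> \int[mu]_x f x <= \int[mu]_x g x.
Proof.
move=> fi gi fg; rewrite -subr_ge0 -RintegralB//.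
have mfg : measurable_fun setT (fun x => g x - f x).
  by apply: measurable_funB; apply/measurable_EFinP/measurable_int;
    [exact: gi|exact: fi].
rewrite (@ae_eq_Rintegral _ (fun x => `|g x - f x|))//.
- by apply: Rintegral_ge0.
- exact: measurableT_comp.
- by apply: filterS fg => x fgx; rewrite ger0_norm// subr_ge0.
Qed.

Lemma hoelder_Rintegral p q f g : 1 <= p -> 1 <= q -> p^-1 + q^-1 = 1 ->
  f \in Lfun mu p%:E -> g \in Lfun mu q%:E ->
  `|\int[mu]_x (f x * g x)| <= Lpnorm p f * Lpnorm q g.
Proof.
move=> p1 q1 pq fp gq.
have mf := Lfun_measurable fp; have mg := Lfun_measurable gq.
have h := @hoelder _ _ _ mu f g p q mf mg
  (lt_le_trans ltr01 p1) (lt_le_trans ltr01 q1) pq.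
rewrite -(EFin_Lpnorm fp) -(EFin_Lpnorm gq) -EFinM in h.
have L1 : f \* g \in Lfun mu 1%:E.
  rewrite inE; apply/andP; split; rewrite inE/=; first exact: measurable_funM.
  by rewrite /finite_norm (le_lt_trans h)// ltry.
have ifg : mu.-integrable setT (EFin \o (fun x => f x * g x)).
  exact/Lfun1_integrable.
apply: le_trans (le_normr_Rintegral measurableT ifg) _.
rewrite -lee_fin; apply: le_trans h; rewrite -EFin_Lpnorm// lee_fin.
rewrite LpnormE// invr1 powRr1; last by apply: Rintegral_ge0 => x _; exact: powR_ge0.
rewrite le_eqVlt; apply/orP; left; apply/eqP; apply: eq_Rintegral => x _.
by rewrite powRr1.
Qed.

Lemma sqr_Lpnorm2 f : Lpnorm 2 f ^+ 2 = \int[mu]_x (f x ^+ 2).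
Proof.
rewrite -powR_mulrn ?Lpnorm_ge0// Lpnorm_powR ?ler1n//.
by apply: eq_Rintegral => x _; rewrite powR_mulrn// real_normK ?num_real.
Qed.

Lemma Lfun2_mul f g : f \in Lfun mu 2%:E -> g \in Lfun mu 2%:E ->
  mu.-integrable setT (EFin \o (fun x => f x * g x)).
Proof. by move=> f2 g2; exact/Lfun1_integrable/Lfun2_mul_Lfun1. Qed.

Lemma cauchy_schwarz_Rintegral f g : f \in Lfun mu 2%:E -> g \in Lfun mu 2%:E ->
  `|\int[mu]_x (f x * g x)| <= Lpnorm 2 f * Lpnorm 2 g.
Proof.
move=> f2 g2; apply: (hoelder_Rintegral _ _ _ f2 g2); rewrite ?ler1n//.
by lra.
Qed.

Lemma normr_mean_le p f : 1 <= p -> f \in Lfun mu p%:E ->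
  `|\int[mu]_x f x| <= Lpnorm p f.
Proof.
rewrite le_eqVlt => /predU1P[<-|p1] fp.
  apply: le_trans (le_normr_Rintegral measurableT (Lfun_int (lexx _) fp)) _.
  rewrite LpnormE// invr1 powRr1; last by apply: Rintegral_ge0 => x _; exact: powR_ge0.
  rewrite le_eqVlt; apply/orP; left; apply/eqP; apply: eq_Rintegral => x _.
  by rewrite powRr1.
pose q := p / (p - 1).
have q1 : 1 <= q by rewrite /q ler_pdivlMr; lra.
have pq : p^-1 + q^-1 = 1 by rewrite /q invf_div; field; lra.
have := hoelder_Rintegral (ltW p1) q1 pq fp (Lfun_cst mu 1 q).
rewrite Lpnorm_cst// normr1 mulr1; apply: le_trans.
by under [X in _ <= `|X|]eq_Rintegral do rewrite /= mulr1.
Qed.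

Lemma spow_Lfun2 p f : 2 < p -> f \in Lfun mu p%:E ->
  (fun x => spow (p / 2) (f x)) \in Lfun mu 2%:E.
Proof.
move=> p2 fp; have p1 : 1 <= p by lra.
have [mf fi] := (LfunP_powR f p1).1 fp.
apply/LfunP_powR; first by rewrite ler1n.
have s0 : 0 < p / 2 by lra.
split; first exact: (measurableT_comp (measurable_spow s0)).
apply: eq_integrable fi => //= x _; congr EFin.
by rewrite powR_mulrn// real_normK ?num_real// sqr_spow; lra.
Qed.

Lemma spow_sqr_int p f : 2 < p ->
  \int[mu]_x (spow (p / 2) (f x) ^+ 2) = \int[mu]_x (`|f x| `^ p).
Proof. by move=> p2; apply: eq_Rintegral => x _; rewrite sqr_spow//; lra. Qed.

(** A reinforced Jensen inequality: the defect dominates half of the variance of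
the signed power of f of exponent p/2, whose square is |f|^p. *)
Lemma jensen_spow p f : 2 < p -> f \in Lfun mu p%:E ->
  `|\int[mu]_x f x| `^ p
    + 2^-1 * (\int[mu]_x (`|f x| `^ p) - (\int[mu]_x spow (p / 2) (f x)) ^+ 2)
  <= \int[mu]_x (`|f x| `^ p).
Proof.
move=> p2 fp; have p1 : 1 <= p by lra.
have [mf fi] := (LfunP_powR f p1).1 fp.
have f1 := Lfun_int p1 fp.
have g2 := spow_Lfun2 p2 fp.
have g1 : mu.-integrable setT (EFin \o (fun x => spow (p / 2) (f x))).
  by apply: (Lfun_int _ g2); rewrite ler1n.
set b := \int[mu]_x f x; set c := spow (p / 2) b.
set A := `|b| `^ p; set k := p * spow (p - 1) b.
(* The tangent inequality at the mean b of f, expanded so that each term is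
   integrable; the integral of the linear term k * (f x - b) vanishes. *)
have h x : A - k * b + 2^-1 * c ^+ 2 + (k * f x + (- c * spow (p / 2) (f x)
    + 2^-1 * (`|f x| `^ p))) <= `|f x| `^ p.
  apply: le_trans (tangent_spow (f x) b p2); rewrite -/A -/k -/c.
  rewrite -(@sqr_spow _ p (f x)); last by lra.
  rewrite le_eqVlt; apply/orP; left; apply/eqP.
  by field.
have i1 : mu.-integrable setT (EFin \o (fun x => k * f x)) by exact: integrable_EFinZ.
have i2 : mu.-integrable setT (EFin \o (fun x => - c * spow (p / 2) (f x))).
  exact: integrable_EFinZ.
have i3 : mu.-integrable setT (EFin \o (fun x => 2^-1 * (`|f x| `^ p))).
  exact: integrable_EFinZ.
have i23 := integrable_EFinD i2 i3.
have i123 := integrable_EFinD i1 i23.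
have icst := integrable_EFin_cst (A - k * b + 2^-1 * c ^+ 2).
have : \int[mu]_x (A - k * b + 2^-1 * c ^+ 2 + (k * f x + (- c * spow (p / 2) (f x)
    + 2^-1 * (`|f x| `^ p)))) <= \int[mu]_x (`|f x| `^ p).
  by apply: le_Rintegral => //; exact: (integrable_EFinD icst i123).
rewrite (RintegralD measurableT icst i123) (RintegralD measurableT i1 i23).
rewrite (RintegralD measurableT i2 i3) !RintegralZl// Rintegral_cst_prob -/b.
set G := \int[mu]_x spow _ _; set I := \int[mu]_x (_ `^ _).
have := sqr_ge0 (c - G); nra.
Qed.

Lemma normr_mean_powR_le p f : 2 < p -> f \in Lfun mu p%:E ->
  `|\int[mu]_x f x| `^ p <= \int[mu]_x (`|f x| `^ p).
Proof.
move=> p2 fp; have p1 : 1 <= p by lra.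
by rewrite -Lpnorm_powR// ge0_ler_powR ?nnegrE ?Lpnorm_ge0 ?normr_mean_le//; lra.
Qed.

(** For a centered f, the variance of the signed power of f of exponent p/2
controls the p-th moment of f. *)
Lemma variance_spow_ge p f : 2 < p -> f \in Lfun mu p%:E -> \int[mu]_x f x = 0 ->
  \int[mu]_x (`|f x| `^ p) <= 2 `^ (2 * p + 1) *
    (\int[mu]_x (`|f x| `^ p) - (\int[mu]_x spow (p / 2) (f x)) ^+ 2).
Proof.
move=> p2 fp f0; have p1 : 1 <= p by lra.
have [mf fi] := (LfunP_powR f p1).1 fp.
have g2 := spow_Lfun2 p2 fp.
have g1 : mu.-integrable setT (EFin \o (fun x => spow (p / 2) (f x))).
  by apply: (Lfun_int _ g2); rewrite ler1n.
set I := \int[mu]_x (_ `^ _); set m := \int[mu]_x spow _ _.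
(* The mean m of the signed power is itself a signed power, of some a. *)
have [a am] : exists a, spow (p / 2) a = m by apply: spow_surj; lra.
have fap : (fun x => f x - a) \in Lfun mu p%:E by apply: LfunB => //; exact: Lfun_cst.
have [_ fai] := (LfunP_powR _ p1).1 fap.
set J := \int[mu]_x (`|f x - a| `^ p).
(* The mean of f - a is - a, since f is centered. *)
have aJ : `|a| `^ p <= J.
  have := normr_mean_powR_le p2 fap.
  rewrite RintegralB//; last 2 first.
    exact: Lfun_int fp.
    exact: integrable_EFin_cst.
  by rewrite f0 Rintegral_cst_prob sub0r normrN.
have IJ : I <= 2 `^ p * (2 * J).
  apply: (@le_trans _ _ (\int[mu]_x (2 `^ p * (`|f x - a| `^ p + `|a| `^ p)))).
    apply: le_Rintegral => //.
      apply: integrable_EFinZ => //; apply: integrable_EFinD => //.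
      exact: integrable_EFin_cst.
    by move=> x _; rewrite -{1}(subrK a (f x)); apply: normrD_powR_le; lra.
  rewrite RintegralZl//; last first.
    by apply: integrable_EFinD => //; exact: integrable_EFin_cst.
  rewrite (RintegralD measurableT fai (integrable_EFin_cst _)).
  by rewrite Rintegral_cst_prob -/J ler_wpM2l ?powR_ge0//; lra.
have JV : J <= 2 `^ p * (I - m ^+ 2).
  have iV : mu.-integrable setT (EFin \o (fun x =>
      `|f x| `^ p + (- (2 * m) * spow (p / 2) (f x) + m ^+ 2))).
    apply: integrable_EFinD => //; apply: integrable_EFinD => //.
      exact: integrable_EFinZ.
    exact: integrable_EFin_cst.
  apply: (@le_trans _ _ (\int[mu]_x (2 `^ p *
      (`|f x| `^ p + (- (2 * m) * spow (p / 2) (f x) + m ^+ 2))))).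
    apply: le_Rintegral => //; first exact: integrable_EFinZ.
    move=> x _; apply: le_trans (sqr_spow_dist (f x) a p2) _.
    rewrite am ler_wpM2l ?powR_ge0// -(@sqr_spow _ p (f x)); last by lra.
    rewrite le_eqVlt; apply/orP; left; apply/eqP; ring.
  rewrite RintegralZl// RintegralD//; last first.
    apply: integrable_EFinD => //; first exact: integrable_EFinZ.
    exact: integrable_EFin_cst.
  rewrite RintegralD//; last 2 first.
    exact: integrable_EFinZ.
    exact: integrable_EFin_cst.
  rewrite RintegralZl// Rintegral_cst_prob -/I -/m ler_wpM2l ?powR_ge0//.
  nra.
apply: (le_trans IJ).
have -> : (2 : R) `^ (2 * p + 1) = 2 `^ p * 2 * 2 `^ p.
  rewrite powRD ?pnatr_eq0 ?implybT// powRr1// [RHS]mulrAC; congr (_ * _).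
  rewrite (_ : 2 * p = p + p); last by ring.
  by rewrite powRD ?pnatr_eq0 ?implybT.
rewrite -!mulrA ler_wpM2l ?powR_ge0//; lra.
Qed.

End Lp_toolkit.

(** * Averaging against a probability kernel *)

Section kernel_operator.
Context d1 d2 (X : measurableType d1) (Y : measurableType d2) (R : realType).
Variable K : R.-pker X ~> Y.

(** [kernel_at x], bundled as [kernel_prob x], is the measure K x seen as a
probability. *)
Definition kernel_at (x : X) : set Y -> \bar R := K x.

Section instances.
Variable x : X.
HB.instance Definition _ := Measure.on (kernel_at x).
Let kernel_at_setT : kernel_at x setT = 1%E.
Proof. exact: prob_kernel. Qed.
HB.instance Definition _ :=
  Measure_isProbability.Build _ _ _ (kernel_at x) kernel_at_setT.
End instances.
Definition kernel_prob x : probability Y R := kernel_at x.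

Lemma integral_kernel_prob x f : (\int[kernel_prob x]_y f y = \int[K x]_y f y)%E.
Proof. exact: eq_measure_integral. Qed.

Lemma integrable_kernel_prob x f : (K x).-integrable setT f ->
  (kernel_prob x).-integrable setT f.
Proof.
by move=> /integrableP[mf fi]; apply/integrableP; rewrite integral_kernel_prob.
Qed.

Lemma measurable_kernel_prob : measurable_fun setT (kernel_prob : X -> giry Y R).
Proof. by apply: measurable_giry_codensity => // B mB; exact: measurable_kernel. Qed.

(** The operator f |-> int f(y) K(., dy); as an integral of real functions, its
value is meaningful at x when f is integrable for K x. *)
Definition kernel_op (f : Y -> R) : X -> R := fun x => \int[K x]_y f y.

Lemma kernel_opE f x : kernel_op f x = \int[kernel_prob x]_y f y.
Proof. by rewrite /kernel_op /Rintegral integral_kernel_prob. Qed.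

Lemma kernel_op_cst c x : kernel_op (fun=> c) x = c.
Proof. by rewrite kernel_opE Rintegral_cst_prob. Qed.

Lemma measurable_kernel_op (f : Y -> R) :
  measurable_fun setT f -> measurable_fun setT (kernel_op f).
Proof.
move=> mf.
rewrite /kernel_op /Rintegral; apply: measurableT_comp => //.
have mEf : measurable_fun setT (EFin \o f) by exact/measurable_EFinP.
under eq_fun do rewrite integralE.
by apply: emeasurable_funB; apply: measurable_fun_integral_kernel => //;
  [exact: measurable_kernel|exact: measurable_funepos
  |exact: measurable_kernel|exact: measurable_funeneg].
Qed.

Section invariance.
Variables (m : probability X R) (nu : {measure set Y -> \bar R}).
(* nu is the law m K of the arrival point when the starting point has law m. *)
Hypothesis nuE : forall A, measurable A -> nu A = (\int[m]_x K x A)%E.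

(** Fubini-Tonelli for the composition m K. *)
Lemma ge0_integral_kernel (f : Y -> \bar R) :
  measurable_fun setT f -> (forall y, 0 <= f y)%E ->
  (\int[nu]_y f y = \int[m]_x \int[K x]_y f y)%E.
Proof.
move=> mf f0.
have := @giry_int_bind _ _ _ _ R (m : giry X R) _ measurable_kernel_prob f mf f0.
rewrite /giry_int => h.
transitivity (\int[m]_x \int[kernel_prob x]_y f y)%E; last first.
  by apply: eq_integral => x _; rewrite integral_kernel_prob.
rewrite -[RHS]h; apply: eq_measure_integral => A mA _.
rewrite nuE//= /giry_bind/= /giry_join/=.
rewrite (@giry_int_map _ _ _ _ _ _ measurable_kernel_prob m (giry_ev ^~ A))//.
exact: measurable_giry_ev.
Qed.

Lemma kernel_op_ge0 (f : Y -> R) : measurable_fun setT f -> (forall y, 0 <= f y) ->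
  nu.-integrable setT (EFin \o f) ->
  [/\ {ae m, forall x, (K x).-integrable setT (EFin \o f)},
      m.-integrable setT (EFin \o kernel_op f) &
      \int[m]_x kernel_op f x = \int[nu]_y f y].
Proof.
move=> mf f0 fi.
have mEf : measurable_fun setT (EFin \o f) by exact/measurable_EFinP.
have Ef0 y : (0 <= (EFin \o f) y)%E by rewrite lee_fin.
have eqint := ge0_integral_kernel mEf Ef0.
have mG : measurable_fun setT (fun x => \int[K x]_y (EFin \o f) y)%E.
  by apply: measurable_fun_integral_kernel => //; exact: measurable_kernel.
have G0 x : (0 <= \int[K x]_y (EFin \o f) y)%E by exact: integral_ge0.
have iG : m.-integrable setT (fun x => \int[K x]_y (EFin \o f) y)%E.
  apply/integrableP; split => //.
  under eq_integral do rewrite gee0_abs//.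
  by rewrite -eqint; exact: integrable_lty.
have aefin : {ae m, forall x, (\int[K x]_y (EFin \o f) y)%E \is a fin_num}.
  by apply: filterS (integrable_ae measurableT iG) => x; apply.
have aeE : {ae m, forall x, (kernel_op f x)%:E = (\int[K x]_y (EFin \o f) y)%E}.
  by apply: filterS aefin => x h; rewrite /kernel_op fineK.
have mk : measurable_fun setT (EFin \o kernel_op f).
  by apply/measurable_EFinP; exact: measurable_kernel_op.
split.
- apply: filterS aefin => x fx; apply/integrableP; split => //.
  under eq_integral do rewrite gee0_abs//.
  by rewrite -ge0_fin_numE.
- apply: (@le_integrable _ _ _ m setT measurableT _ _ mk _ iG) => x _.
  have fine_le (z : \bar R) : (`|(fine z)%:E| <= `|z|)%E.
    by case: z => [r| |] /=; rewrite ?lexx ?normr0 ?leey.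
  exact: fine_le.
- rewrite /Rintegral; congr fine; rewrite eqint; apply: ae_eq_integral => //.
  by apply: filterS aeE => x h _.
Qed.

(** Fubini for the composition m K.  For m and nu equal to an invariant measure,
it makes the operator well defined almost everywhere; for m = P_s(x, .), K = P_t
and nu = P_(s+t)(x, .), it is the semigroup property at x. *)
Lemma kernel_op_integrable (f : Y -> R) : nu.-integrable setT (EFin \o f) ->
  [/\ {ae m, forall x, (K x).-integrable setT (EFin \o f)},
      m.-integrable setT (EFin \o kernel_op f) &
      \int[m]_x kernel_op f x = \int[nu]_y f y].
Proof.
move=> fi.
have mf : measurable_fun setT f by apply/measurable_EFinP; exact: measurable_int fi.
(* f is the difference of two nonnegative integrable functions. *)
pose h y := `|f y|; pose g y := f y + `|f y|.
have hi : nu.-integrable setT (EFin \o h) by exact: integrable_norm.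
have gi : nu.-integrable setT (EFin \o g) by exact: integrable_EFinD.
have mh : measurable_fun setT h by exact: measurableT_comp.
have mg : measurable_fun setT g by exact: measurable_funD.
have g0 y : 0 <= g y by rewrite /g; have := ler_norm (- f y); rewrite normrN; lra.
have [ha him hint] := kernel_op_ge0 mh (fun y => normr_ge0 (f y)) hi.
have [ga gim gint] := kernel_op_ge0 mg g0 gi.
have fE : f = (fun y => g y - h y) by apply/funext => y; rewrite /g addrK.
have fa : {ae m, forall x, (K x).-integrable setT (EFin \o f)}.
  by apply: filterS2 ha ga => x hx gx; rewrite fE; exact: integrable_EFinB.
have opE : {ae m, forall x, kernel_op f x = kernel_op g x - kernel_op h x}.
  by apply: filterS2 ha ga => x hx gx; rewrite {1}fE /kernel_op RintegralB.
have mk := measurable_kernel_op mf.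
have mB : measurable_fun setT (fun x => kernel_op g x - kernel_op h x).
  by apply: measurable_funB; exact: measurable_kernel_op.
have iB : m.-integrable setT (EFin \o (fun x => kernel_op g x - kernel_op h x)).
  exact: integrable_EFinB.
split => //.
- apply/Lfun1_integrable; apply: (@ae_eq_Lfun _ _ _ m 1
    (fun x => kernel_op g x - kernel_op h x)) => //.
    by apply: filterS opE => x ->.
  exact/Lfun1_integrable.
- rewrite (ae_eq_Rintegral mk mB opE) RintegralB// hint gint [in RHS]fE.
  by rewrite RintegralB.
Qed.

End invariance.
End kernel_operator.

(** * Scalar products in L^2 *)

Section L2_calculus.
Context d (T : measurableType d) (R : realType) (mu : probability T R).
Implicit Types (f g h : T -> R).

Lemma Lfun2_int f : f \in Lfun mu 2%:E -> mu.-integrable setT (EFin \o f).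
Proof. by apply: Lfun_int; rewrite ler1n. Qed.

(** Modulus of continuity of the scalar product. *)
Lemma dot_perturb f g h k : f \in Lfun mu 2%:E -> g \in Lfun mu 2%:E ->
  h \in Lfun mu 2%:E -> k \in Lfun mu 2%:E ->
  `|\int[mu]_x (f x * g x) - \int[mu]_x (h x * k x)| <=
   Lpnorm mu 2 (fun x => f x - h x) * Lpnorm mu 2 g +
   Lpnorm mu 2 h * Lpnorm mu 2 (fun x => g x - k x).
Proof.
move=> f2 g2 h2 k2; have two1 : (1 : R) <= 2 by rewrite ler1n.
have fh := LfunB two1 f2 h2; have gk := LfunB two1 g2 k2.
rewrite -RintegralB//; [|exact: Lfun2_mul|exact: Lfun2_mul].
have -> : \int[mu]_x (f x * g x - h x * k x) =
    \int[mu]_x ((f x - h x) * g x) + \int[mu]_x (h x * (g x - k x)).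
  rewrite -RintegralD//; [|exact: Lfun2_mul|exact: Lfun2_mul].
  by apply: eq_Rintegral => x _; ring.
by apply: le_trans (ler_normD _ _) _; apply: lerD; exact: cauchy_schwarz_Rintegral.
Qed.

Lemma int_sqr_center f : f \in Lfun mu 2%:E ->
  \int[mu]_x ((f x - \int[mu]_y f y) ^+ 2) =
  \int[mu]_x (f x ^+ 2) - (\int[mu]_x f x) ^+ 2.
Proof.
move=> f2; set m := \int[mu]_y f y.
have -> : \int[mu]_x ((f x - m) ^+ 2) =
    \int[mu]_x (f x ^+ 2 + (- (2 * m) * f x + m ^+ 2)).
  by apply: eq_Rintegral => x _; ring.
have i1 := Lfun2_integrable_sqr f2; have i2 := integrable_EFinZ (- (2 * m)) (Lfun2_int f2).
have i3 := integrable_EFin_cst mu (m ^+ 2).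
rewrite (RintegralD measurableT i1 (integrable_EFinD i2 i3)).
rewrite (RintegralD measurableT i2 i3) RintegralZl//; last exact: Lfun2_int.
by rewrite Rintegral_cst_prob -/m; ring.
Qed.

End L2_calculus.

(** * The semigroup on the L^p spaces *)

Section semigroup_facts.
Context (R : realType) (E : completePseudoMetricType R).
Context (mu : probability (borel E) R).
Context (P : R -> R.-pker (borel E) ~> (borel E)).
Hypothesis semigroupP : symmetric_ergodic_markov_semigroup mu P.
Implicit Types (f g u : borel E -> R) (s t p c eps rho : R).

Local Notation S := (semigroup P).

Lemma semigroupE t f : S t f = kernel_op (P t) f. Proof. by []. Qed.

Lemma measurable_semigroup t f : measurable_fun setT f -> measurable_fun setT (S t f).
Proof. exact: measurable_kernel_op. Qed.

Lemma semigroup_cst t c x : S t (fun=> c) x = c.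
Proof. exact: kernel_op_cst. Qed.

(** Stationarity: the symmetry of P_t, tested on 1 and the indicator of A. *)
Lemma semigroup_invariant t A : 0 <= t -> measurable A ->
  mu A = (\int[mu]_x P t x A)%E.
Proof.
move=> t0 mA.
have one2 : cst 1 \in Lfun mu 2%:E by exact: Lfun_cst.
have A2 : (\1_A : borel E -> R) \in Lfun mu 2%:E.
  apply: (@Lfun_bounded _ _ _ mu 2 1); rewrite ?ler1n// => x.
  by rewrite indicE ger0_norm// lern1 leq_b1.
have := semigroup_symmetric semigroupP t0 one2 A2.
have S1 x : S t (\1_A) x = fine (P t x A).
  by rewrite /semigroup /Rintegral integral_indic// setIT.
under eq_Rintegral do rewrite /= mul1r S1.
under [RHS]eq_Rintegral do rewrite /= semigroup_cst mul1r.
rewrite /Rintegral integral_indic// setIT.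
have fin x : P t x A \is a fin_num by exact: finite_kernel_measure.
under eq_integral do rewrite fineK//.
have mPA : measurable_fun setT (fun x => P t x A) by exact: measurable_kernel.
have PA_fin : (\int[mu]_x P t x A)%E \is a fin_num.
  rewrite ge0_fin_numE; last by apply: integral_ge0 => x _; exact: measure_ge0.
  apply: (@le_lt_trans _ _ (\int[mu]_x (cst 1%E x))%E).
    apply: ge0_le_integral => // x _.
    by apply: (probability_le1 (kernel_prob (P t) x)).
  by apply: integrable_lty => //; exact: (integrable_EFin_cst mu 1).
have muA_fin : mu A \is a fin_num by exact: fin_num_measure.
by move=> h; rewrite -(fineK PA_fin) -(fineK muA_fin) h.
Qed.

Section one_time.
Variable t : R.
Hypothesis t0 : 0 <= t.

Let invt A (mA : measurable A) := semigroup_invariant t0 mA.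

Lemma semigroup_integrable f : mu.-integrable setT (EFin \o f) ->
  [/\ {ae mu, forall x, (P t x).-integrable setT (EFin \o f)},
      mu.-integrable setT (EFin \o S t f) &
      \int[mu]_x S t f x = \int[mu]_x f x].
Proof. by move=> fi; exact: (kernel_op_integrable invt fi). Qed.

Lemma semigroupZ c f : mu.-integrable setT (EFin \o f) ->
  {ae mu, forall x, S t (fun y => c * f y) x = c * S t f x}.
Proof.
move=> fi; have [ae_f _ _] := semigroup_integrable fi.
by apply: filterS ae_f => x fx; rewrite /semigroup RintegralZl.
Qed.

Lemma semigroupB f g : mu.-integrable setT (EFin \o f) ->
  mu.-integrable setT (EFin \o g) ->
  {ae mu, forall x, S t (fun y => f y - g y) x = S t f x - S t g x}.
Proof.
move=> fi gi; have [ae_f _ _] := semigroup_integrable fi.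
have [ae_g _ _] := semigroup_integrable gi.
by apply: filterS2 ae_f ae_g => x fx gx; rewrite /semigroup RintegralB.
Qed.

Lemma semigroup_Lfun p f : 1 <= p -> f \in Lfun mu p%:E ->
  S t f \in Lfun mu p%:E /\ Lpnorm mu p (S t f) <= Lpnorm mu p f.
Proof.
move=> p1 fp.
have le : (Lp_norm mu p%:E (S t f) <= Lp_norm mu p%:E f)%E.
  by apply: semigroup_contraction => //; rewrite lee_fin.
have Sp : S t f \in Lfun mu p%:E.
  rewrite inE; apply/andP; split; rewrite inE/=.
    by apply: measurable_semigroup; exact: Lfun_measurable fp.
  by rewrite /finite_norm (le_lt_trans le)// /Lp_norm -EFin_Lpnorm// ltry.
by split => //; rewrite -lee_fin !EFin_Lpnorm.
Qed.

End one_time.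

(** The semigroup property.  It holds almost everywhere, namely where f is
integrable for P_(s+t)(x, .). *)
Lemma semigroup_comp s t f : 0 <= s -> 0 <= t -> mu.-integrable setT (EFin \o f) ->
  {ae mu, forall x, S s (S t f) x = S (s + t) f x}.
Proof.
move=> s0 t0 fi; have [ae_f _ _] := semigroup_integrable (addr_ge0 s0 t0) fi.
apply: filterS ae_f => x fx.
have nuE (A : set (borel E)) : measurable A ->
    P (s + t) x A = (\int[kernel_prob (P s) x]_y P t y A)%E.
  by move=> mA; rewrite (chapman_kolmogorov semigroupP)// integral_kernel_prob.
have [_ _] := kernel_op_integrable nuE fx.
by rewrite -/(S (s + t) f x) => <-; rewrite -kernel_opE.
Qed.

Lemma semigroup_sym t f g : 0 <= t -> f \in Lfun mu 2%:E -> g \in Lfun mu 2%:E ->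
  \int[mu]_x (f x * S t g x) = \int[mu]_x (S t f x * g x).
Proof. exact: semigroup_symmetric. Qed.

(** If P_t contracts variances by a factor rho, it contracts the p-th moments of
centered functions: integrate [jensen_spow] for the laws P_t(x, .), and compare
the variance of the signed power of u with its p-th moment. *)
Lemma semigroup_moment_step p t rho u : 2 < p -> 0 <= t -> rho <= 1 ->
  (forall g, g \in Lfun mu 2%:E -> \int[mu]_x (S t g x ^+ 2) - (\int[mu]_x g x) ^+ 2
     <= rho * (\int[mu]_x (g x ^+ 2) - (\int[mu]_x g x) ^+ 2)) ->
  u \in Lfun mu p%:E -> \int[mu]_x u x = 0 ->
  \int[mu]_x (`|S t u x| `^ p) <=
    (1 - (1 - rho) / 2 / 2 `^ (2 * p + 1)) * \int[mu]_x (`|u x| `^ p).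
Proof.
move=> p2 t0 rho1 gap up u0; have p1 : 1 <= p by lra.
have [meas_u ui] := (LfunP_powR mu u p1).1 up.
pose g x := spow (p / 2) (u x); pose v x := `|u x| `^ p.
have g2 : g \in Lfun mu 2%:E := spow_Lfun2 p2 up.
have [Su _] := semigroup_Lfun t0 p1 up.
have [Sg _] := semigroup_Lfun t0 (ler1n R 2 : 1 <= 2) g2.
have [_ Sui] := (LfunP_powR mu _ p1).1 Su.
have Sg2 := Lfun2_integrable_sqr Sg.
have [aev Svi Svint] := semigroup_integrable t0 (f := v) ui.
have iv : mu.-integrable setT (EFin \o (fun x => 2^-1 * (S t v x - S t g x ^+ 2))).
  by apply: integrable_EFinZ; apply: integrable_EFinB.
have : \int[mu]_x (`|S t u x| `^ p + 2^-1 * (S t v x - S t g x ^+ 2))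
    <= \int[mu]_x S t v x.
  apply: ae_le_Rintegral => //; first exact: integrable_EFinD.
  apply: filterS aev => x vx.
  have ux : u \in Lfun (kernel_prob (P t) x) p%:E.
    by apply/LfunP_powR => //; split => //; exact: integrable_kernel_prob.
  have := jensen_spow p2 ux.
  by rewrite -!kernel_opE.
rewrite RintegralD// RintegralZl//; last exact: integrable_EFinB.
rewrite RintegralB// Svint -/v.
have := variance_spow_ge p2 up u0.
have := gap g g2; rewrite {1}/g spow_sqr_int//.
have K0 : 0 < (2 : R) `^ (2 * p + 1) by rewrite powR_gt0.
set W := \int[mu]_x `|S t u x| `^ p.
rewrite /v /g.
set I := \int[mu]_x `|u x| `^ p; set m := \int[mu]_x spow _ (u x).
set Q := \int[mu]_x (S t _ x ^+ 2).
move=> h1; rewrite -ler_pdivrMl// => h2 h3.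
have : (1 - rho) * ((2 `^ (2 * p + 1))^-1 * I) <= (1 - rho) * (I - m ^+ 2).
  by rewrite ler_wpM2l//; lra.
move: h1 h3; rewrite mulrBl mul1r; set k := (2 `^ _)^-1.
nra.
Qed.

(** * Spectral gap *)

Context (D : set (borel E -> R)) (L : (borel E -> R) -> (borel E -> R)) (CP : R).
Hypothesis coreD : smooth_core mu P D L.
Hypothesis CP_gt0 : 0 < CP.
Hypothesis poincareCP : poincare mu D L CP.

Local Notation nrm := (Lpnorm mu 2).

Let two1 : (1 : R) <= 2. Proof. by rewrite ler1n. Qed.

(** The error (P_t f - f)/t - g, which tends to 0 in L^2 as t tends to 0 when g is
the image of f under the generator. *)
Definition diff_quotient t f g : borel E -> R :=
  fun x => t^-1 * (S t f x - f x) - g x.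

Lemma diff_quotient_Lfun2 t f g : 0 <= t -> f \in Lfun mu 2%:E ->
  g \in Lfun mu 2%:E -> diff_quotient t f g \in Lfun mu 2%:E.
Proof.
move=> t0 f2 g2; have [Sf _] := semigroup_Lfun t0 two1 f2.
by apply: LfunB => //; apply: LfunZ => //; exact: LfunB.
Qed.

Lemma generator_near f g eps : generator mu P 2%:E f g -> 0 < eps ->
  exists2 d : R, 0 < d &
    forall t, 0 < t -> t < d -> nrm (diff_quotient t f g) < eps.
Proof.
move=> [f2 g2 fg] eps0.
have : \forall t \near 0^'+, (Lp_norm mu 2%:E (diff_quotient t f g) < eps%:E)%E.
  have e0E : (0 < eps%:E)%E by rewrite lte_fin.
  exact: (fg _ (open_ereal_lt' e0E)).
rewrite /at_right /within/= => -[d/= d0 h]; exists d => // t t0 td.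
rewrite -lte_fin EFin_Lpnorm; last exact: diff_quotient_Lfun2 (ltW t0) f2 g2.
by apply: h => //=; rewrite sub0r normrN gtr0_norm.
Qed.

Lemma smooth_Lfun2 f : D f -> f \in Lfun mu 2%:E.
Proof. by move=> Df; have [] := smooth_generator coreD Df. Qed.

Lemma smooth_L_Lfun2 f : D f -> L f \in Lfun mu 2%:E.
Proof. by move=> Df; have [] := smooth_generator coreD Df. Qed.

(** By stationarity the difference quotients of f have mean 0. *)
Lemma int_generator0 f g : generator mu P 2%:E f g -> \int[mu]_x g x = 0.
Proof.
move=> fg; have [f2 g2 _] := fg.
apply/eqP; rewrite -normr_le0; apply/ler_addgt0Pr => eps eps0; rewrite add0r.
have [d d0 h] := generator_near fg eps0.
have t0 : 0 < d / 2 by lra.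
have := h _ t0; rewrite (_ : d / 2 < d); last by lra.
move=> /(_ isT)/ltW; apply: le_trans.
have [Sf _] := semigroup_Lfun (ltW t0) two1 f2.
have q2 := diff_quotient_Lfun2 (ltW t0) f2 g2.
have := normr_mean_le two1 q2.
rewrite RintegralB//; last 2 first.
- by apply: Lfun2_int; apply: LfunZ => //; exact: LfunB.
- exact: Lfun2_int.
rewrite RintegralZl//; last by apply: Lfun2_int; exact: LfunB.
rewrite RintegralB//; [|exact: Lfun2_int|exact: Lfun2_int].
have [_ _ ->] := semigroup_integrable (ltW t0) (Lfun2_int f2).
by rewrite subrr mulr0 sub0r normrN.
Qed.

(** The integral of Gamma(f, f) is that of - f L f, because L (f^2) has mean 0. *)
Lemma poincare_core f : D f ->
  \int[mu]_x (f x ^+ 2) - (\int[mu]_x f x) ^+ 2 <= - CP * \int[mu]_x (f x * L f x).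
Proof.
move=> Df; have f2 := smooth_Lfun2 Df; have Lf2 := smooth_L_Lfun2 Df.
have Dff := smoothM coreD Df Df; have Lff2 := smooth_L_Lfun2 Dff.
have Lff0 := int_generator0 (smooth_generator coreD Dff).
have GE : \int[mu]_x Gamma L f f x = - \int[mu]_x (f x * L f x).
  have -> : Gamma L f f = (fun x => 2^-1 * L (f \* f) x - f x * L f x).
    by apply/funext => x; rewrite /Gamma; field.
  rewrite RintegralB//; [|exact: (integrable_EFinZ _ (Lfun2_int Lff2))|exact: Lfun2_mul].
  by rewrite RintegralZl//; [rewrite Lff0 mulr0 sub0r|exact: Lfun2_int].
have := poincareCP Df; rewrite varianceE// GE.
have f1 := Lfun2_int f2; have ff := Lfun2_integrable_sqr f2.
rewrite unlock /=.
rewrite (_ : (\int[mu]_x ((f ^+ 2) x)%:E)%E = (\int[mu]_x (f x ^+ 2))%:E).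
  rewrite (_ : (\int[mu]_x (f x)%:E)%E = (\int[mu]_x f x)%:E).
    by rewrite -EFinM -EFinB -expr2 lee_fin mulrN mulNr.
  by rewrite /Rintegral fineK//; exact: integrable_fin_num.
by rewrite /Rintegral fineK//; exact: integrable_fin_num.
Qed.

(** Poincare's inequality on the whole domain of the generator, by density of the
core for the graph norm. *)
Lemma poincare_generator f g : generator mu P 2%:E f g ->
  \int[mu]_x (f x ^+ 2) - (\int[mu]_x f x) ^+ 2 <= - CP * \int[mu]_x (f x * g x).
Proof.
move=> fg; have [f2 g2 _] := fg.
pose a := nrm f; pose b := nrm g.
have a0 : 0 <= a := Lpnorm_ge0 _ _ _; have b0 : 0 <= b := Lpnorm_ge0 _ _ _.
(* If h in the core is such that h and L h are within e <= 1 of f and g, the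
   two sides of the inequality change by at most e * M. *)
pose M := 2 * (2 * a + 1) + CP * (a + b + 1).
have M0 : 0 < M.
  have : 0 < CP * (a + b + 1) by apply: mulr_gt0 => //; lra.
  by rewrite /M; lra.
apply/ler_addgt0Pr => eps eps0.
pose e := Num.min 1 (eps / M).
have e0 : 0 < e by rewrite /e lt_min ltr01 divr_gt0.
have e1 : e <= 1 by rewrite /e ge_min lexx.
have eM : e * M <= eps by rewrite -ler_pdivlMr// /e ge_min lexx orbT.
have [h [Dh fh gLh]] := smooth_graph_dense coreD fg e0.
have h2 := smooth_Lfun2 Dh; have Lh2 := smooth_L_Lfun2 Dh.
have fh2 := LfunB two1 f2 h2; have gLh2 := LfunB two1 g2 Lh2.
have {}fh : nrm (fun x => f x - h x) < e by rewrite -lte_fin EFin_Lpnorm.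
have {}gLh : nrm (fun x => g x - L h x) < e by rewrite -lte_fin EFin_Lpnorm.
have fh0 : 0 <= nrm (fun x => f x - h x) := Lpnorm_ge0 _ _ _.
have gLh0 : 0 <= nrm (fun x => g x - L h x) := Lpnorm_ge0 _ _ _.
have nh : nrm h <= a + e.
  have := LpnormD two1 f2 (LfunN two1 fh2).
  rewrite LpnormN (_ : (fun x => f x + - (f x - h x)) = h); last first.
    by apply/funext => x; ring.
  by rewrite -/a; lra.
have h0 : 0 <= nrm h := Lpnorm_ge0 _ _ _.
have := dot_perturb f2 f2 h2 h2; have := dot_perturb f2 g2 h2 Lh2.
rewrite -/a -/b => d1 d2.
have d3 : `|\int[mu]_x f x - \int[mu]_x h x| <= nrm (fun x => f x - h x).
  rewrite -RintegralB//; [|exact: Lfun2_int|exact: Lfun2_int].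
  exact: normr_mean_le.
have d4 : `|\int[mu]_x f x| <= a by exact: normr_mean_le.
have := poincare_core Dh.
have sqE k : \int[mu]_x (k x ^+ 2) = \int[mu]_x (k x * k x).
  by apply: eq_Rintegral => x _; rewrite expr2.
rewrite !sqE.
move: d1 d2 d3 d4.
set I1 := \int[mu]_x (f x * g x); set I2 := \int[mu]_x (h x * L h x).
set I3 := \int[mu]_x (f x * f x); set I4 := \int[mu]_x (h x * h x).
set I5 := \int[mu]_x f x; set I6 := \int[mu]_x h x.
set n1 := nrm (fun x => f x - h x) in fh fh0 *.
set n2 := nrm (fun x => g x - L h x) in gLh gLh0 *.
move=> d1 d2 d3 d4 PI.
have {}d1 : I2 <= I1 + e * (a + b + 1) /\ I1 <= I2 + e * (a + b + 1).
  move: d1; rewrite ler_norml => /andP[]; split; nra.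
have {}d2 : I3 <= I4 + e * (2 * a + 1).
  move: d2; rewrite ler_norml => /andP[]; nra.
have {}d3 : I6 ^+ 2 <= I5 ^+ 2 + e * (2 * a + 1).
  move: d3 d4; rewrite !ler_norml => /andP[? ?] /andP[? ?]; nra.
apply: le_trans (_ : - CP * I1 + e * M <= _); last by rewrite lerD2l.
have : CP * I1 <= CP * (I2 + e * (a + b + 1)).
  by rewrite ler_wpM2l ?(ltW CP_gt0)//; exact: d1.2.
by move: PI d2 d3; rewrite /M; lra.
Qed.

(** P_s commutes with difference quotients and is a contraction, so that the
error at (P_s f, P_s g) is bounded uniformly in s. *)
Lemma diff_quotient_semigroup s t f g : 0 <= s -> 0 <= t ->
  f \in Lfun mu 2%:E -> g \in Lfun mu 2%:E ->
  nrm (diff_quotient t (S s f) (S s g)) <= nrm (diff_quotient t f g).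
Proof.
move=> s0 t0 f2 g2.
have [Ssf _] := semigroup_Lfun s0 two1 f2.
have [Ssg _] := semigroup_Lfun s0 two1 g2.
have [Stf _] := semigroup_Lfun t0 two1 f2.
have q2 := diff_quotient_Lfun2 t0 f2 g2.
have [Sq Sq_le] := semigroup_Lfun s0 two1 q2.
have q2' := diff_quotient_Lfun2 t0 Ssf Ssg.
apply: le_trans Sq_le.
rewrite (@ae_eq_Lpnorm _ _ _ mu 2 _ (S s (diff_quotient t f g)) two1)//.
- exact: Lfun_measurable q2'.
- exact: Lfun_measurable Sq.
have i1 := Lfun2_int (LfunB two1 Stf f2).
have aB := semigroupB s0 (integrable_EFinZ t^-1 i1) (Lfun2_int g2).
have aZ := semigroupZ s0 t^-1 i1.
have aB' := semigroupB s0 (Lfun2_int Stf) (Lfun2_int f2).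
have c1 := semigroup_comp s0 t0 (Lfun2_int f2).
have c2 := semigroup_comp t0 s0 (Lfun2_int f2).
near=> x.
have -> : S s (diff_quotient t f g) x =
    S s (fun y => t^-1 * (S t f y - f y)) x - S s g x.
  by near: x; exact: aB.
have -> : S s (fun y => t^-1 * (S t f y - f y)) x =
    t^-1 * S s (fun y => S t f y - f y) x.
  by near: x; exact: aZ.
have -> : S s (fun y => S t f y - f y) x = S s (S t f) x - S s f x.
  by near: x; exact: aB'.
have -> : S s (S t f) x = S (s + t) f x by near: x; exact: c1.
rewrite /diff_quotient; have -> : S t (S s f) x = S (t + s) f x by near: x; exact: c2.
by rewrite (addrC t s).
Unshelve. all: by end_near. Qed.

Lemma generator_semigroup s f g : 0 <= s -> generator mu P 2%:E f g ->
  generator mu P 2%:E (S s f) (S s g).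
Proof.
move=> s0 [f2 g2 fg].
have [Ssf _] := semigroup_Lfun s0 two1 f2.
have [Ssg _] := semigroup_Lfun s0 two1 g2.
split => //.
apply: (squeeze_cvge _ (cvg_cst 0%E) fg).
near=> t; rewrite /Lp_norm Lnorm_ge0/=.
have t0 : 0 <= t by [].
rewrite -!EFin_Lpnorm; [|exact: diff_quotient_Lfun2|exact: diff_quotient_Lfun2].
by rewrite lee_fin; exact: diff_quotient_semigroup.
Unshelve. all: by end_near. Qed.

(** One step of length h in the discretization of d/dt |P_t f|^2 <= - 2 |P_t f|^2 / C_P;
the symmetry of P_h replaces the square of P_h u by the scalar product of u and
P_2h u, so that no term of order h^2 appears. *)
Lemma gap_step f g s (h : R) : generator mu P 2%:E f g -> \int[mu]_x f x = 0 ->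
  0 <= s -> 0 < h ->
  nrm (S (h + s) f) ^+ 2 <= (1 - 2 * h / CP) * nrm (S s f) ^+ 2
    + 2 * h * (nrm f * nrm (diff_quotient (2 * h) f g)).
Proof.
move=> fg f0 s0 h0; have [f2 g2 _] := fg; have h0' := ltW h0.
have hh0 : 0 <= 2 * h by lra.
have [u2 u_le] := semigroup_Lfun s0 two1 f2.
have [ug2 _] := semigroup_Lfun s0 two1 g2.
have [Su2 _] := semigroup_Lfun h0' two1 u2.
have [Shs2 _] := semigroup_Lfun (addr_ge0 h0' s0) two1 f2.
have [SSu2 _] := semigroup_Lfun h0' two1 Su2.
have [S2u2 _] := semigroup_Lfun hh0 two1 u2.
have [_ _ u0] := semigroup_integrable s0 (Lfun2_int f2).
rewrite f0 in u0.
set u := S s f in u2 u_le Su2 SSu2 S2u2 u0 *; set ug := S s g in ug2 *.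
have -> : nrm (S (h + s) f) = nrm (S h u).
  apply/esym/(ae_eq_Lpnorm two1); [exact: Lfun_measurable Su2|exact: Lfun_measurable Shs2|].
  exact: (semigroup_comp h0' s0 (Lfun2_int f2)).
pose r := diff_quotient (2 * h) u ug.
have r2 : r \in Lfun mu 2%:E by exact: diff_quotient_Lfun2.
have r_le : nrm r <= nrm (diff_quotient (2 * h) f g) by exact: diff_quotient_semigroup.
have E1 : nrm (S h u) ^+ 2 = \int[mu]_x (u x * S (2 * h) u x).
  rewrite sqr_Lpnorm2; under eq_Rintegral do rewrite expr2.
  rewrite -(semigroup_sym h0' u2 Su2); apply: ae_eq_Rintegral.
  - by apply: measurable_funM; [exact: Lfun_measurable u2|exact: Lfun_measurable SSu2].
  - by apply: measurable_funM; [exact: Lfun_measurable u2|exact: Lfun_measurable S2u2].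
  - apply: filterS (semigroup_comp h0' h0' (Lfun2_int u2)) => x ->.
    by rewrite (_ : h + h = 2 * h)//; ring.
have E2 : \int[mu]_x (u x * S (2 * h) u x) =
    \int[mu]_x (u x ^+ 2) + 2 * h * (\int[mu]_x (u x * ug x) + \int[mu]_x (u x * r x)).
  have i1 := Lfun2_integrable_sqr u2; have i2 := Lfun2_mul u2 ug2; have i3 := Lfun2_mul u2 r2.
  have -> : \int[mu]_x (u x * S (2 * h) u x) =
      \int[mu]_x (u x ^+ 2 + 2 * h * (u x * ug x + u x * r x)).
    apply: eq_Rintegral => x _; rewrite /r /diff_quotient.
    by move: (u x) (ug x) (S _ _ x) => a b c; field; rewrite gt_eqF.
  rewrite (RintegralD measurableT i1 (integrable_EFinZ _ (integrable_EFinD i2 i3))).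
  by rewrite (RintegralZl _ measurableT (integrable_EFinD i2 i3)) (RintegralD measurableT i2 i3).
have cs := cauchy_schwarz_Rintegral u2 r2.
have PI := poincare_generator (generator_semigroup s0 fg).
move: PI; rewrite -/u -/ug u0 expr0n/= subr0 => PI.
rewrite E1 E2 -sqr_Lpnorm2; rewrite -sqr_Lpnorm2 in PI.
have b1 : \int[mu]_x (u x * ug x) <= - (nrm u ^+ 2 / CP).
  by rewrite -mulNr ler_pdivlMr// mulrC lerNr -mulNr.
have b2 : \int[mu]_x (u x * r x) <= nrm f * nrm (diff_quotient (2 * h) f g).
  apply: le_trans (ler_norm _) (le_trans cs _).
  by apply: ler_pM => //; exact: Lpnorm_ge0.
apply: le_trans (lerD (lexx _) (ler_wpM2l hh0 (lerD b1 b2))) _.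
by rewrite le_eqVlt; apply/orP; left; apply/eqP; ring.
Qed.

(** The errors of the n steps add up to at most a geometric series, of sum
C_P / (2h) times the error of one step. *)
Lemma gap_iter f g (h : R) n : generator mu P 2%:E f g -> \int[mu]_x f x = 0 ->
  0 < h -> 2 * h <= CP ->
  nrm (S (n%:R * h) f) ^+ 2 <= CP * (nrm f * nrm (diff_quotient (2 * h) f g))
    + (1 - 2 * h / CP) ^+ n * nrm f ^+ 2.
Proof.
move=> fg f0 h0 hC; have [f2 g2 _] := fg.
set eta := nrm f * _.
have eta0 : 0 <= eta by apply: mulr_ge0; exact: Lpnorm_ge0.
have d0 : 0 <= 1 - 2 * h / CP by rewrite subr_ge0 ler_pdivrMr// mul1r.
elim: n => [|n IH].
  rewrite mul0r expr0 mul1r.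
  have [_ le] := semigroup_Lfun (lexx 0) two1 f2.
  have : nrm (S 0 f) ^+ 2 <= nrm f ^+ 2 by rewrite lerXn2r ?nnegrE ?Lpnorm_ge0.
  have : 0 <= CP * eta by rewrite mulr_ge0// ltW.
  by lra.
have nh0 : 0 <= n%:R * h by rewrite mulr_ge0// ltW.
have -> : n.+1%:R * h = h + n%:R * h by rewrite -natr1; ring.
apply: le_trans (gap_step fg f0 nh0 h0) _; rewrite -/eta.
have := ler_wpM2l d0 IH; rewrite (exprS _ n).
move: ((1 - 2 * h / CP) ^+ n) => q.
have -> : (1 - 2 * h / CP) * (CP * eta + q * nrm f ^+ 2) =
  CP * eta - 2 * h * eta + (1 - 2 * h / CP) * q * nrm f ^+ 2.
  by field; rewrite gt_eqF.
lra.
Qed.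

Lemma gap_generator f g t : generator mu P 2%:E f g -> \int[mu]_x f x = 0 ->
  0 <= t -> nrm (S t f) <= expR (- (t / CP)) * nrm f.
Proof.
move=> fg f0; have [f2 g2 _] := fg; rewrite le_eqVlt => /predU1P[<-|t0].
  rewrite mul0r oppr0 expR0 mul1r.
  by have [_] := semigroup_Lfun (lexx 0) two1 f2.
have nf0 : 0 <= nrm f := Lpnorm_ge0 _ _ _.
rewrite -(@ler_pXn2r _ 2)// ?nnegrE ?mulr_ge0 ?expR_ge0 ?Lpnorm_ge0//.
rewrite exprMn -expRM_natl; apply/ler_addgt0Pr => eps eps0.
pose e := eps / (CP * (nrm f + 1)).
have K0 : 0 < CP * (nrm f + 1) by apply: mulr_gt0 => //; lra.
have e0 : 0 < e by rewrite divr_gt0.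
have [d d0 dP] := generator_near fg e0.
pose d' := Num.min d CP.
have d'0 : 0 < d' by rewrite lt_min d0.
(* The time step t/n is small enough for the error term to be below eps. *)
pose n := (Num.truncn (2 * t / d')).+1.
have n0 : 0 < n%:R :> R by rewrite ltr0n.
have hd : 2 * (t / n%:R) < d'.
  have : 2 * t / d' < n%:R by rewrite /n truncnS_gt.
  by rewrite ltr_pdivrMr// => ?; rewrite mulrA ltr_pdivrMr// [ltRHS]mulrC.
have h0 : 0 < t / n%:R by rewrite divr_gt0.
have hC : 2 * (t / n%:R) <= CP.
  by apply: (le_trans (ltW hd)); rewrite /d' ge_min lexx orbT.
have hd1 : 2 * (t / n%:R) < d by apply: (lt_le_trans hd); rewrite /d' ge_min lexx.
have hh0 : 0 < 2 * (t / n%:R) by lra.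
have r_lt := dP _ hh0 hd1.
have := gap_iter n fg f0 h0 hC.
have -> : n%:R * (t / n%:R) = t by rewrite mulrC divfK// gt_eqF.
move/le_trans; apply; rewrite addrC; apply: lerD; last first.
  have r0 : 0 <= nrm (diff_quotient (2 * (t / n%:R)) f g) := Lpnorm_ge0 _ _ _.
  have : CP * (nrm f + 1) * nrm (diff_quotient (2 * (t / n%:R)) f g) <= eps.
    by rewrite mulrC -ler_pdivlMr// ltW.
  have : 0 <= CP * nrm (diff_quotient (2 * (t / n%:R)) f g) by rewrite mulr_ge0// ltW.
  by lra.
rewrite ler_wpM2r ?sqr_ge0//.
have -> : (2 * - (t / CP) : R) = n%:R * (- (2 * (t / n%:R) / CP)).
  by field; rewrite !gt_eqF.
rewrite expRM_natl lerXn2r ?nnegrE ?expR_ge0//.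
  by rewrite subr_ge0 ler_pdivrMr// mul1r.
exact: expR_ge1Dx.
Qed.

Lemma gap_centered f t : f \in Lfun mu 2%:E -> \int[mu]_x f x = 0 ->
  0 <= t -> nrm (S t f) <= expR (- (t / CP)) * nrm f.
Proof.
move=> f2 f0 t0; apply/ler_addgt0Pr => eps eps0.
have e0 : 0 < eps / 4 by lra.
(* The approximation h0 of f in the core is recentered within the core. *)
have [h0 Dh0 fh0] := smooth_dense coreD f2 e0.
pose h x := h0 x + (- \int[mu]_y h0 y).
have Dh : D h by apply: (smoothD coreD) => //; exact: smooth_cst coreD _.
have h02 := smooth_Lfun2 Dh0; have h2 := smooth_Lfun2 Dh.
have fh02 := LfunB two1 f2 h02; have fh2 := LfunB two1 f2 h2.
have hint : \int[mu]_x h x = 0.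
  rewrite RintegralD//; [|exact: Lfun2_int|exact: integrable_EFin_cst].
  by rewrite Rintegral_cst_prob subrr.
have {}fh0 : nrm (fun x => f x - h0 x) < eps / 4 by rewrite -lte_fin EFin_Lpnorm.
have m_le : `|\int[mu]_y h0 y| <= nrm (fun x => f x - h0 x).
  have := normr_mean_le two1 fh02.
  by rewrite RintegralB//; [rewrite f0 sub0r normrN|exact: Lfun2_int|exact: Lfun2_int].
have fh : nrm (fun x => f x - h x) <= eps / 2.
  rewrite (@eq_Lpnorm _ _ _ mu _ _ (fun x => (f x - h0 x) + cst (\int[mu]_y h0 y) x)).
    apply: le_trans (LpnormD two1 fh02 (Lfun_cst _ _ _)) _.
    by rewrite Lpnorm_cst//; lra.
  by move=> x /=; rewrite /h; ring.
have := gap_generator (smooth_generator coreD Dh) hint t0.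
have [Sf2 _] := semigroup_Lfun t0 two1 f2.
have [Sh2 _] := semigroup_Lfun t0 two1 h2.
have [Sfh2 Sfh] := semigroup_Lfun t0 two1 fh2.
have le1 : nrm (S t f) <= nrm (S t h) + nrm (S t (fun x => f x - h x)).
  apply: le_trans (LpnormD two1 Sh2 Sfh2).
  rewrite le_eqVlt; apply/orP; left; apply/eqP; apply: (ae_eq_Lpnorm two1).
  - exact: Lfun_measurable Sf2.
  - by apply: measurable_funD; [exact: Lfun_measurable Sh2|exact: Lfun_measurable Sfh2].
  - apply: filterS (semigroupB t0 (Lfun2_int f2) (Lfun2_int h2)) => x ->.
    by rewrite subrKC.
have le2 : nrm h <= nrm f + eps / 2.
  apply: (@le_trans _ _ (nrm f + nrm (fun x => - (f x - h x)))).
    apply: le_trans (LpnormD two1 f2 (LfunN two1 fh2)).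
    rewrite le_eqVlt; apply/orP; left; apply/eqP; apply: eq_Lpnorm => x; ring.
  by rewrite LpnormN lerD2l.
have E0 : 0 <= expR (- (t / CP)) := expR_ge0 _.
have E1 : expR (- (t / CP)) <= 1.
  by rewrite -expR0 ler_expR oppr_le0 divr_ge0// ltW.
have := ler_wpM2l E0 le2.
have : expR (- (t / CP)) * (eps / 2) <= 1 * (eps / 2) by rewrite ler_wpM2r//; lra.
lra.
Qed.

(** P_t contracts variances exponentially. *)
Lemma spectral_gap f t : f \in Lfun mu 2%:E -> 0 <= t ->
  \int[mu]_x (S t f x ^+ 2) - (\int[mu]_x f x) ^+ 2 <=
  expR (- (2 * t / CP)) * (\int[mu]_x (f x ^+ 2) - (\int[mu]_x f x) ^+ 2).
Proof.
move=> f2 t0; set m := \int[mu]_x f x.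
pose f0 x := f x - m.
have f02 : f0 \in Lfun mu 2%:E by apply: LfunB => //; exact: Lfun_cst.
have f0int : \int[mu]_x f0 x = 0.
  rewrite RintegralB//; [|exact: Lfun2_int|exact: integrable_EFin_cst].
  by rewrite Rintegral_cst_prob subrr.
have [Sf2 _] := semigroup_Lfun t0 two1 f2.
have [Sf02 _] := semigroup_Lfun t0 two1 f02.
have [_ _ Sm] := semigroup_integrable t0 (Lfun2_int f2).
have := gap_centered f02 f0int t0.
rewrite -(@ler_pXn2r _ 2)// ?nnegrE ?mulr_ge0 ?expR_ge0 ?Lpnorm_ge0//.
rewrite exprMn -expRM_natl !sqr_Lpnorm2 int_sqr_center// -/m.
rewrite (_ : 2 * - (t / CP) = - (2 * t / CP)); last by ring.
apply: le_trans; rewrite -/m in Sm; rewrite -{1}Sm -int_sqr_center//.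
rewrite le_eqVlt; apply/orP; left; apply/eqP; apply: ae_eq_Rintegral.
- apply: measurable_funX; apply: measurable_funB => //; exact: Lfun_measurable Sf2.
- by apply: measurable_funX; exact: Lfun_measurable Sf02.
- apply: filterS (semigroupB t0 (Lfun2_int f2) (integrable_EFin_cst mu m)) => x ->.
  by rewrite semigroup_cst Sm.
Qed.

(** * Decay in L^p for p > 2 *)

(** The exponential rate obtained in L^p, p > 2. *)
Definition decay_rate p : R := (2 `^ (2 * p + 2) * p * CP)^-1.

Lemma decay_rate_gt0 p : 0 < p -> 0 < decay_rate p.
Proof. by move=> p0; rewrite invr_gt0 !mulr_gt0// powR_gt0. Qed.

(** For a time step h <= C_P / 2, the factor of [semigroup_moment_step] with
rho = exp(-2h/C_P) is at most exp(- p * decay_rate p * h). *)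
Lemma moment_step p (h : R) u : 2 < p -> 0 <= h -> 2 * h <= CP ->
  u \in Lfun mu p%:E -> \int[mu]_x u x = 0 ->
  \int[mu]_x (`|S h u x| `^ p) <=
    expR (- (p * decay_rate p * h)) * \int[mu]_x (`|u x| `^ p).
Proof.
move=> p2 h0 hC up u0.
pose rho := expR (- (2 * h / CP)).
have y0 : 0 <= 2 * h / CP by rewrite divr_ge0 ?mulr_ge0// ltW.
have y1 : 2 * h / CP <= 1 by rewrite ler_pdivrMr// mul1r.
have rho_le := expRN_le y0 y1; rewrite -/rho in rho_le.
have rho1 : rho <= 1 by lra.
have gap g (g2 : g \in Lfun mu 2%:E) :=
  spectral_gap g2 h0.
apply: le_trans (semigroup_moment_step p2 h0 rho1 gap up u0) _.
rewrite ler_wpM2r//; first by apply: Rintegral_ge0 => x _; exact: powR_ge0.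
have K0 : 0 < (2 : R) `^ (2 * p + 1) by rewrite powR_gt0.
apply: le_trans (expR_ge1Dx _); rewrite lerD2l lerN2.
have -> : p * decay_rate p * h = h / CP / 2 / 2 `^ (2 * p + 1).
  rewrite /decay_rate (_ : 2 * p + 2 = 2 * p + 1 + 1); last by ring.
  rewrite (@powRD _ 2 (2 * p + 1)) ?pnatr_eq0 ?implybT// powRr1//.
  by field; rewrite !gt_eqF//; lra.
rewrite ler_pM2r ?invr_gt0// ler_pM2r ?invr_gt0//.
have <- : 2 * h / CP / 2 = h / CP by field; rewrite gt_eqF.
by move: rho_le; move: (_ / 2) => y; lra.
Qed.

Lemma moment_iter p (h : R) f n : 2 < p -> 0 <= h -> 2 * h <= CP ->
  f \in Lfun mu p%:E -> \int[mu]_x f x = 0 ->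
  \int[mu]_x (`|S (n%:R * h) f x| `^ p) <=
    expR (- (p * decay_rate p * (n%:R * h))) * \int[mu]_x (`|f x| `^ p).
Proof.
move=> p2 h0 hC fp f0; have p1 : 1 <= p by lra.
elim: n => [|n IH].
  rewrite mul0r mulr0 oppr0 expR0 mul1r -!Lpnorm_powR//.
  have [_ le] := semigroup_Lfun (lexx 0) p1 fp.
  by apply: ge0_ler_powR; rewrite ?nnegrE ?Lpnorm_ge0//; lra.
have nh0 : 0 <= n%:R * h by rewrite mulr_ge0.
have [up _] := semigroup_Lfun nh0 p1 fp.
have [_ _ u0] := semigroup_integrable nh0 (Lfun_int p1 fp).
rewrite f0 in u0.
have -> : n.+1%:R * h = h + n%:R * h by rewrite -natr1; ring.
have [Sup _] := semigroup_Lfun h0 p1 up.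
have [Shp _] := semigroup_Lfun (addr_ge0 h0 nh0) p1 fp.
rewrite (@ae_eq_Rintegral _ _ _ mu _ (fun x => `|S h (S (n%:R * h) f) x| `^ p)).
- apply: le_trans (moment_step p2 h0 hC up u0) _.
  rewrite mulrDr opprD expRD -[leRHS]mulrA ler_wpM2l ?expR_ge0//.
- by apply: measurable_normr_powR; exact: Lfun_measurable Shp.
- by apply: measurable_normr_powR; exact: Lfun_measurable Sup.
- apply: filterS (semigroup_comp h0 nh0 (Lfun_int p1 fp)) => x.
  by move=> ->.
Qed.

Lemma Lp_decay p f t : 2 < p -> f \in Lfun mu p%:E -> \int[mu]_x f x = 0 ->
  0 <= t -> Lpnorm mu p (S t f) <= expR (- (decay_rate p * t)) * Lpnorm mu p f.
Proof.
move=> p2 fp f0 t0; have p1 : 1 <= p by lra.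
(* The time t is divided into n steps of length at most C_P / 2. *)
pose n := (Num.truncn (2 * t / CP)).+1.
have n0 : 0 < n%:R :> R by rewrite ltr0n.
have h0 : 0 <= t / n%:R by rewrite divr_ge0// ltW.
have hC : 2 * (t / n%:R) <= CP.
  have : 2 * t / CP < n%:R by rewrite /n truncnS_gt.
  by rewrite ltr_pdivrMr// => ?; rewrite mulrA ler_pdivrMr// [leRHS]mulrC ltW.
have := moment_iter n p2 h0 hC fp f0.
have -> : n%:R * (t / n%:R) = t by rewrite mulrC divfK// gt_eqF.
rewrite -!Lpnorm_powR//.
have -> : expR (- (p * decay_rate p * t)) = expR (- (decay_rate p * t)) `^ p.
  by rewrite -expRM; congr expR; ring.
rewrite -powRM ?expR_ge0 ?Lpnorm_ge0// => le.
rewrite leNgt; apply/negP => lt.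
have : (expR (- (decay_rate p * t)) * Lpnorm mu p f) `^ p < Lpnorm mu p (S t f) `^ p.
  by apply: gt0_ltr_powR; rewrite ?nnegrE ?mulr_ge0 ?expR_ge0 ?Lpnorm_ge0//; lra.
by rewrite ltNge le.
Qed.

Lemma semigroup_bounded t f M x : measurable_fun setT f ->
  (forall y, `|f y| <= M) -> `|S t f x| <= M.
Proof.
move=> mf fM; rewrite semigroupE kernel_opE.
have fi : (kernel_prob (P t) x).-integrable setT (EFin \o f).
  by apply: (Lfun_int (lexx 1)); exact: (Lfun_bounded _ (lexx _) mf fM).
apply: le_trans (le_normr_Rintegral measurableT fi) _.
rewrite -[leRHS](Rintegral_cst_prob (kernel_prob (P t) x)).
apply: le_Rintegral => //; first exact: integrable_norm.
exact: integrable_EFin_cst.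
Qed.

Lemma Lp_center p f : 1 <= p -> f \in Lfun mu p%:E ->
  [/\ (fun x => f x - \int[mu]_y f y) \in Lfun mu p%:E,
      \int[mu]_x (f x - \int[mu]_y f y) = 0 &
      Lpnorm mu p (fun x => f x - \int[mu]_y f y) <= 2 * Lpnorm mu p f].
Proof.
move=> p1 fp; split.
- by apply: LfunB => //; exact: Lfun_cst.
- rewrite RintegralB//; [|exact: Lfun_int fp|exact: integrable_EFin_cst].
  by rewrite Rintegral_cst_prob subrr.
- apply: le_trans (LpnormD p1 fp (Lfun_cst mu (- \int[mu]_y f y) p)) _.
  by rewrite Lpnorm_cst// normrN; have := normr_mean_le p1 fp; lra.
Qed.

Lemma semigroup_center t p f : 0 <= t -> 1 <= p -> f \in Lfun mu p%:E ->
  Lpnorm mu p (fun x => S t f x - \int[mu]_y S t f y) =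
  Lpnorm mu p (S t (fun x => f x - \int[mu]_y f y)).
Proof.
move=> t0 p1 fp.
have [f0p _ _] := Lp_center p1 fp.
have [Sfp _] := semigroup_Lfun t0 p1 fp.
have [Sf0p _] := semigroup_Lfun t0 p1 f0p.
have [_ _ ->] := semigroup_integrable t0 (Lfun_int p1 fp).
apply: (ae_eq_Lpnorm p1); last 1 first.
- have := semigroupB t0 (Lfun_int p1 fp) (integrable_EFin_cst mu (\int[mu]_y f y)).
  by apply: filterS => x ->; rewrite semigroup_cst.
- apply: measurable_funB => //; exact: Lfun_measurable Sfp.
- exact: Lfun_measurable Sf0p.
Qed.

Lemma centered_normE p f : 1 <= p -> f \in Lfun mu p%:E ->
  centered_norm mu p f = (Lpnorm mu p (fun x => f x - \int[mu]_y f y))%:E.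
Proof. by move=> p1 fp; rewrite EFin_Lpnorm//; have [] := Lp_center p1 fp. Qed.

Lemma centered_norm_semigroup t p f : 0 <= t -> 1 <= p -> f \in Lfun mu p%:E ->
  centered_norm mu p (S t f) = (Lpnorm mu p (S t (fun x => f x - \int[mu]_y f y)))%:E.
Proof.
move=> t0 p1 fp; have [Sfp _] := semigroup_Lfun t0 p1 fp.
by rewrite centered_normE// semigroup_center.
Qed.

(** * Decay in L^p for 1 < p < 2 *)

(** For bounded f, the symmetry of P_t in L^2 can be applied to the pair (w, f),
where w is the function dual to P_t f. *)
Lemma dual_decay_bounded p f t M : 1 < p -> p < 2 -> measurable_fun setT f ->
  (forall x, `|f x| <= M) -> \int[mu]_x f x = 0 -> 0 <= t ->
  Lpnorm mu p (S t f) <=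
    2 * expR (- (decay_rate (p / (p - 1)) * t)) * Lpnorm mu p f.
Proof.
move=> p1 p2 mf fM f0 t0.
set q := p / (p - 1).
have q2 : 2 < q by rewrite /q ltr_pdivlMr; lra.
have q1 : 1 <= q by lra.
have p1' : 1 <= p by lra.
have qp : q^-1 + p^-1 = 1 by rewrite /q invf_div; field; lra.
have f2 := Lfun_bounded mu two1 mf fM; have fp := Lfun_bounded mu p1' mf fM.
pose v := S t f.
have vM x : `|v x| <= M by exact: semigroup_bounded.
have mv : measurable_fun setT v by exact: measurable_semigroup.
have pm0 : 0 < p - 1 by lra.
(* w v = |v|^p = |w|^q, hence A^p is the scalar product of w and v = P_t f. *)
pose w x := spow (p - 1) (v x).
have mw : measurable_fun setT w by exact: (measurableT_comp (measurable_spow pm0)).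
have wM x : `|w x| <= M `^ (p - 1).
  rewrite normr_spow//; apply: ge0_ler_powR; rewrite ?nnegrE//; first lra.
  exact: le_trans (vM x).
have w2 := Lfun_bounded mu two1 mw wM; have wq := Lfun_bounded mu q1 mw wM.
pose A := Lpnorm mu p v.
have A0 : 0 <= A := Lpnorm_ge0 _ _ _.
have wvE x : w x * v x = `|v x| `^ p.
  rewrite /w /spow mulrC mulrA [v x * _]mulrC -normrEsg mulr_powRB1//; lra.
have wqE : \int[mu]_x (`|w x| `^ q) = A `^ p.
  rewrite (Lpnorm_powR mu v p1'); apply: eq_Rintegral => x _.
  by rewrite normr_spow// -powRrM /q mulrC divfK ?gt_eqF.
have nw : Lpnorm mu q w = A `^ (p - 1).
  by rewrite (LpnormE mu w q1) wqE -powRrM /q invf_div mulrC divfK ?gt_eqF//; lra.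
have [w0q w0int w0le] := Lp_center q1 wq.
have [Sw2 _] := semigroup_Lfun t0 two1 w2.
have [Swq _] := semigroup_Lfun t0 q1 wq.
have [Sw0q' _ _] := Lp_center q1 Swq.
pose m := \int[mu]_y S t w y.
(* P_t w may be centered since f is. *)
have ApE : A `^ p = \int[mu]_x ((S t w x - m) * f x).
  rewrite (Lpnorm_powR mu v p1').
  transitivity (\int[mu]_x (w x * S t f x)).
    by apply: eq_Rintegral => x _; rewrite -wvE.
  rewrite (semigroup_sym t0 w2 f2).
  have i1 := Lfun2_mul Sw2 f2; have i2 := integrable_EFinZ m (Lfun2_int f2).
  under [RHS]eq_Rintegral do rewrite mulrBl.
  rewrite (RintegralB measurableT i1 i2) RintegralZl//; last exact: Lfun2_int.
  by rewrite f0 mulr0 subr0.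
have : A `^ p <= 2 * expR (- (decay_rate q * t)) * Lpnorm mu p f * A `^ (p - 1).
  rewrite ApE; apply: le_trans (ler_norm _) _.
  apply: le_trans (hoelder_Rintegral q1 p1' qp Sw0q' fp) _.
  rewrite semigroup_center// mulrAC; apply: ler_wpM2r; first exact: Lpnorm_ge0.
  apply: le_trans (Lp_decay q2 w0q w0int t0) _.
  by rewrite mulrAC -nw [leRHS]mulrC; apply: ler_wpM2l => //; exact: expR_ge0.
rewrite -/v -/A; have [->|An0] := eqVneq A 0.
  by move=> _; rewrite !mulr_ge0 ?expR_ge0 ?Lpnorm_ge0.
have Agt0 : 0 < A by rewrite lt_def An0.
by rewrite -mulr_powRB1//; [rewrite ler_pM2r// powR_gt0|lra].
Qed.

(** Truncations of f converge to f in L^p. *)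
Lemma bounded_dense p f eps : 1 <= p -> f \in Lfun mu p%:E -> 0 < eps ->
  exists h : borel E -> R, [/\ measurable_fun setT h, exists M, forall x, `|h x| <= M &
    Lpnorm mu p (fun x => f x - h x) < eps].
Proof.
move=> p1 fp eps0; have [mf fi] := (LfunP_powR mu f p1).1 fp.
have p0 : 0 < p by lra.
pose h (n : nat) (x : borel E) := if `|f x| <= n%:R then f x else 0.
have mh n : measurable_fun setT (h n).
  apply: measurable_fun_ifT => //; apply: measurable_fun_ler => //.
  exact: measurableT_comp.
have hM n x : `|h n x| <= n%:R by rewrite /h; case: ifPn => // _; rewrite normr0.
have hf n x : `|f x - h n x| `^ p <= `|f x| `^ p.
  apply: ge0_ler_powR; rewrite ?nnegrE ?(ltW p0)// /h; case: ifPn => _.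
    by rewrite subrr normr0.
  by rewrite subr0.
have [] := @dominated_convergence _ _ _ mu setT measurableT
  (fun n x => (`|f x - h n x| `^ p)%:E) (cst 0%E) (fun x => (`|f x| `^ p)%:E).
- move=> n; apply/measurable_EFinP; apply: measurable_normr_powR.
  exact: measurable_funB.
- exact: measurable_cst.
- apply: aeW => x _; apply: (@cvg_near_cst _ _ 0%E).
  near=> n; rewrite /h ifT; first by rewrite subrr normr0 powR0 ?gt_eqF.
  apply: ltW; apply: lt_le_trans (truncnS_gt _) _.
  by rewrite ler_nat; near: n; exact: nbhs_infty_ge.
- exact: fi.
- by apply: aeW => x n _ /=; rewrite lee_fin ger0_norm ?powR_ge0.
move=> _ _; rewrite integral0.
have e0E : (0 < (eps `^ p)%:E)%E by rewrite lte_fin powR_gt0.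
move=> /(_ _ (open_ereal_lt' e0E)) [n _ /(_ n (leqnn n))/= lt].
exists (h n); split => //; first by exists n%:R.
have hp : h n \in Lfun mu p%:E := Lfun_bounded mu p1 (mh n) (hM n).
have [_ di] := (LfunP_powR mu _ p1).1 (LfunB p1 fp hp).
have : Lpnorm mu p (fun x => f x - h n x) `^ p < eps `^ p.
  rewrite Lpnorm_powR// -lte_fin /Rintegral fineK//.
  exact: integrable_fin_num.
move=> {}lt; rewrite ltNge; apply/negP => le; move: lt; rewrite ltNge => /negP; apply.
by apply: ge0_ler_powR; rewrite ?nnegrE ?Lpnorm_ge0 ?(ltW p0) ?(ltW eps0).
Unshelve. all: by end_near. Qed.

Lemma dual_decay p f t : 1 < p -> p < 2 -> f \in Lfun mu p%:E ->
  \int[mu]_x f x = 0 -> 0 <= t ->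
  Lpnorm mu p (S t f) <=
    2 * expR (- (decay_rate (p / (p - 1)) * t)) * Lpnorm mu p f.
Proof.
move=> p1 p2 fp f0 t0; have p1' : 1 <= p by lra.
set e := expR _; have e0 : 0 <= e := expR_ge0 _.
apply/ler_addgt0Pr => eps eps0.
(* If f is approximated within d by a bounded function, centering the latter
   gives an approximation within 2 d, and the error on the decay is at most
   2 e (2 d) + 2 d = K d. *)
pose K := 4 * e + 2; have K0 : 0 < K by rewrite /K; lra.
have d0 : 0 < eps / K by rewrite divr_gt0.
have [h [mh [M hM] fh]] := bounded_dense p1' fp d0.
have hp := Lfun_bounded mu p1' mh hM.
have [h0p h0int _] := Lp_center p1' hp.
pose h0 x := h x - \int[mu]_y h y; rewrite -/h0 in h0p h0int.
have mh0 := Lfun_measurable h0p.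
have h0M x : `|h0 x| <= M + `|\int[mu]_y h y|.
  by apply: le_trans (ler_normB _ _) _; rewrite lerD2r.
have fhp := LfunB p1' fp hp.
have m_le : `|\int[mu]_y h y| <= Lpnorm mu p (fun x => f x - h x).
  have := normr_mean_le p1' fhp.
  rewrite RintegralB//; [|exact: Lfun_int fp|exact: Lfun_int hp].
  by rewrite f0 sub0r normrN.
have fh0p := LfunB p1' fp h0p.
have fh0 : Lpnorm mu p (fun x => f x - h0 x) <= 2 * (eps / K).
  rewrite (@eq_Lpnorm _ _ _ mu _ _ (fun x => (f x - h x) + cst (\int[mu]_y h y) x)).
    apply: le_trans (LpnormD p1' fhp (Lfun_cst _ _ _)) _.
    by rewrite Lpnorm_cst//; lra.
  by move=> x /=; rewrite /h0; ring.
have := dual_decay_bounded p1 p2 mh0 h0M h0int t0; rewrite -/e => H.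
have [Sfp _] := semigroup_Lfun t0 p1' fp.
have [Sh0p _] := semigroup_Lfun t0 p1' h0p.
have [Sdp Sd_le] := semigroup_Lfun t0 p1' fh0p.
have le1 : Lpnorm mu p (S t f) <=
    Lpnorm mu p (S t h0) + Lpnorm mu p (S t (fun x => f x - h0 x)).
  apply: le_trans (LpnormD p1' Sh0p Sdp).
  rewrite le_eqVlt; apply/orP; left; apply/eqP; apply: (ae_eq_Lpnorm p1').
  - exact: Lfun_measurable Sfp.
  - by apply: measurable_funD; [exact: Lfun_measurable Sh0p|exact: Lfun_measurable Sdp].
  - apply: filterS (semigroupB t0 (Lfun_int p1' fp) (Lfun_int p1' h0p)) => x ->.
    by rewrite subrKC.
have le2 : Lpnorm mu p h0 <= Lpnorm mu p f + 2 * (eps / K).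
  apply: (@le_trans _ _ (Lpnorm mu p f + Lpnorm mu p (fun x => - (f x - h0 x)))).
    apply: le_trans (LpnormD p1' fp (LfunN p1' fh0p)).
    rewrite le_eqVlt; apply/orP; left; apply/eqP; apply: eq_Lpnorm => x; ring.
  by rewrite LpnormN lerD2l.
apply: le_trans le1 _; apply: le_trans (lerD H (le_trans Sd_le fh0)) _.
have := ler_wpM2l (mulr_ge0 (ler0n R 2) e0) le2.
have -> : 2 * e * (Lpnorm mu p f + 2 * (eps / K)) =
    2 * e * Lpnorm mu p f + (eps - 2 * (eps / K)).
  by rewrite /K; field; rewrite gt_eqF//; lra.
lra.
Qed.

End semigroup_facts.

(** * The explicit rate *)

(** With q = 2^(k+1) >= p, the claim reduces to (2q + 2) + (k + 1) + (k + 6) <= 7q,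
which follows from q >= k + 2. *)
Lemma decay_rate_ge (R : realType) (CP p : R) (k : nat) : 0 < CP -> (1 < k)%N ->
  2 ^+ k < p -> p <= 2 ^+ (k + 1) ->
  2 ^+ (k + 6) / (2 ^+ (7 * 2 ^ (k + 1)) * CP) <= decay_rate CP p.
Proof.
move=> C0 k1 kp pk.
have p0 : 0 < p by apply: lt_trans kp; rewrite exprn_gt0.
set q := (2 ^ (k + 1))%N.
have qE : q%:R = 2 ^+ (k + 1) :> R by rewrite natrX.
have X0 : 0 < (2 : R) `^ (2 * p + 2) by rewrite powR_gt0.
have XE : (2 : R) `^ (2 * p + 2) <= 2 ^+ (2 * q + 2).
  rewrite -powR_mulrn// ler_powR ?ler1n// natrD natrM qE.
  by rewrite lerD2r ler_wpM2l.
have kq : (k + 1 < q)%N by rewrite /q ltn_expl.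
have key : 2 `^ (2 * p + 2) * p * 2 ^+ (k + 6) <= (2 : R) ^+ (7 * q).
  apply: (@le_trans _ _ (2 ^+ (2 * q + 2) * 2 ^+ (k + 1) * 2 ^+ (k + 6))).
    rewrite ler_wpM2r ?exprn_ge0//; apply: ler_pM => //; exact: ltW.
  by rewrite -!exprD ler_eXn2l ?ltr1n//; lia.
have a0 : 0 < (2 : R) ^+ (k + 6) by rewrite exprn_gt0.
have b0 : 0 < (2 : R) ^+ (7 * q) by rewrite exprn_gt0.
rewrite /decay_rate ler_pdivrMr ?mulr_gt0// ler_pdivlMl ?mulr_gt0//.
by rewrite (mulrAC _ CP) ler_pM2r.
Qed.

Unset Implicit Arguments.
Set Strict Implicit.
Set Printing Implicit Defensive.

Theorem theorem1p4 (R : realType) (E : completePseudoMetricType R)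
    (mu : probability (borel E) R) (P : R -> R.-pker (borel E) ~> (borel E))
    (D : set (borel E -> R)) (L : (borel E -> R) -> (borel E -> R)) (CP : R)
    (polishE : polish E)
    (semigroupP : symmetric_ergodic_markov_semigroup mu P)
    (coreD : smooth_core mu P D L)
    (diffusionL : diffusion mu P D L)
    (CP_gt0 : 0 < CP)
    (poincareCP : poincare mu D L CP) :
  exists lambda : R -> R,
    (forall p : R, 2 < p ->
      [/\ 0 < lambda p,
          forall (f : borel E -> R) (t : R), f \in Lfun mu p%:E -> 0 <= t ->
            (centered_norm mu p (semigroup P t f)
               <= (expR (- (lambda p * t)))%:E * centered_norm mu p f)%E &
          forall k : nat, (1 < k)%N -> 2 ^+ k < p -> p <= 2 ^+ (k + 1) ->
            2 ^+ (k + 6) / (2 ^+ (7 * 2 ^ (k + 1)) * CP) <= lambda p]) /\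
    (forall p : R, 1 < p -> p < 2 ->
      forall (f : borel E -> R) (t : R), f \in Lfun mu p%:E -> 0 <= t ->
        (centered_norm mu p (semigroup P t f)
           <= (2 * expR (- (lambda (p / (p - 1)) * t)))%:E
              * centered_norm mu p f)%E).
Proof.
exists (decay_rate CP); split=> [p p2|p p1 p2 f t fp t0].
  have p1 : 1 <= p by lra.
  split=> [|f t fp t0|k k1 kp pk]; last exact: decay_rate_ge.
    by apply: decay_rate_gt0 => //; lra.
  have [f0p f0int _] := Lp_center p1 fp.
  rewrite (centered_normE p1 fp) (centered_norm_semigroup semigroupP t0 p1 fp).
  rewrite -EFinM lee_fin.
  exact: (Lp_decay semigroupP coreD CP_gt0 poincareCP p2 f0p f0int t0).
have p1' := ltW p1.
have [f0p f0int _] := Lp_center p1' fp.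
rewrite (centered_normE p1' fp) (centered_norm_semigroup semigroupP t0 p1' fp).
rewrite -EFinM lee_fin.
exact: (dual_decay semigroupP coreD CP_gt0 poincareCP p1 p2 f0p f0int t0).
Qed.
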